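(* Let $(M,F)$ be a Finsler manifold admitting a concurrent $\pi$-vector field $\overline{\varphi}$ with associated $\pi$-form $\phi=i_{\overline{\varphi}}g$; put $\Phi=\phi(\overline{\eta})$, $p^2=g(\overline\varphi,\overline\varphi)$. Let $\widehat F=\frac{F^2}{F-\Phi}$ on $\mathcal D=\{(x,y)\in TM : F(x,y)>\Phi(x,y)\}$ be a conic pseudo-Finsler structure satisfying $F(1+2p^2)-3\Phi\ne0$ on $\mathcal D$. Then on $\mathcal D$ the Cartan torsion $\widehat{\mathbf T}$ of $\widehat F$ and the Cartan torsion $\mathbf T$ of $F$ are related, for all $\pi$-vector fields $\overline W,\overline Y,\overline Z$, by $$\begin{aligned}2\widehat{\mathbf T}(\overline W,\overline Y,\overline Z)={}&\frac{2F^2(F-2\Phi)}{(F-\Phi)^3}\mathbf T(\overline W,\overline Y,\overline Z)\\&+\frac{F\Phi(4\Phi-F)}{(F-\Phi)^4}\left\{\hbar(\overline W,\overline Z)\ell(\overline Y)+\hbar(\overline Y,\overline Z)\ell(\overline W)\right\}\\&+\frac{F^2(F-4\Phi)}{(F-\Phi)^4}\left\{\hbar(\overline W,\overline Z)\phi(\overline Y)+\hbar(\overline Y,\overline Z)\phi(\overline W)\right\}\\&+\left(D^\circ_{\gamma\overline Z}\frac{F^2(F-2\Phi)}{(F-\Phi)^3}\right)g(\overline W,\overline Y)+\left(D^\circ_{\gamma\overline Z}\Big(\frac{3F^4}{(F-\Phi)^4}\,\phi\otimes\phi\Big)\right)(\overline W,\overline Y)\\&+\left(D^\circ_{\gamma\overline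 Z}\frac{F^2\Phi(4\Phi-F)}{(F-\Phi)^4}\right)\ell(\overline W)\ell(\overline Y)\\&+\left(D^\circ_{\gamma\overline Z}\frac{F^3(F-4\Phi)}{(F-\Phi)^4}\right)\left\{\phi(\overline W)\ell(\overline Y)+\phi(\overline Y)\ell(\overline W)\right\}.\end{aligned}$$
   Context: Setting. $M$ is an $n$-dimensional paracompact smooth manifold, $\pi:TM\to M$ its tangent bundle, $\mathcal TM=TM\setminus\{0\}$ the slit tangent bundle. $\pi$-vector fields are smooth sections of the pullback of the bundle $TM\to M$ over $\mathcal TM$ (local basis $\overline{\partial}_i$); $\pi$-forms/tensors are the corresponding (dual) tensor sections. $\gamma$ is the natural injection (vertical lift) $\gamma(W^i\overline\partial_i)=W^i\partial_{y^i}$, $\rho(a^i\partial_{x^i}+b^i\partial_{y^i})=a^i\overline\partial_i$, $J=\gamma\circ\rho$, $\overline\eta(u)=(u,u)$ (i.e. $\overline\eta=y^i\overline\partial_i$), $\mathcal C=\gamma\overline\eta$, and $d_Jf=df\circ J$ for functions $f$. Finsler structure: $F:TM\to[0,\infty)$, $C^\infty$ on $\mathcal TM$, $C^0$ on $TM$, positively homogeneous of degree 1 in $y$, with $dd_JE$ of maximal rank, $E=\frac12F^2$. Metric tensor: $g(\rho W,\rho Z)=dd_JE(JW,Z)$ (it is positive definite). Supporting form $\ell=F^{-1}i_{\overline\eta}g$; angular metric tensor $\hbar=g-\ell\otimes\ell$. Geodesic spray $G$: $JG=\mathcal C$, $[\mathcal C,G]=G$, $i_Gdd_JE=-dE$.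 Barthel connection $\Gamma=[J,G]$ (i.e. $\Gamma X=[JX,G]-J[X,G]$), projectors $h=\frac12(I+\Gamma)$, $v=\frac12(I-\Gamma)$, horizontal map $\beta=(\rho|_{\mathrm{Im}\,h})^{-1}$. Berwald connection $D^\circ$: $\gamma D^\circ_{hZ}\rho W=v[hZ,JW]$, $D^\circ_{\gamma\overline Z}\overline W=\rho[\gamma\overline Z,\beta\overline W]$, extended to functions ($D^\circ_Xf=X\cdot f$) and tensors as usual. Cartan torsion $\mathbf T$: $2\mathbf T(\overline W,\overline Y,\overline Z)=(D^\circ_{\gamma\overline Z}g)(\overline W,\overline Y)$. Cartan connection $\nabla$: determined by $2g(\nabla_{\gamma\overline X}\overline Y,\overline Z)=\gamma\overline X\cdot g(\overline Y,\overline Z)+g(\overline Y,\rho[\beta\overline Z,\gamma\overline X])+g(\overline Z,\rho[\gamma\overline X,\beta\overline Y])$ and $2g(\nabla_{\beta\overline X}\overline Y,\overline Z)=\beta\overline X\cdot g(\overline Y,\overline Z)+\beta\overline Y\cdot g(\overline Z,\overline X)-\beta\overline Z\cdot g(\overline X,\overline Y)-g(\overline X,\rho[\beta\overline Y,\beta\overline Z])+g(\overline Y,\rho[\beta\overline Z,\beta\overline X])+g(\overline Z,\rho[\beta\overline X,\beta\overline Y])$. Concurrent $\pi$-vector field: a non-vanishing $\pi$-vector field $\overline\varphi$ with $\nabla_{\beta\overline W}\overline\varphi=-\overline W=D^\circ_{\beta\overline W}\overline\varphi$ and $\nabla_{\gamma\overline W}\overline\varphi=0=D^\circ_{\gamma\overline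 W}\overline\varphi$ for all $\overline W$. Conic pseudo-Finsler structure on $M$: a smooth function to $[0,\infty)$ on a conic sub-bundle $\mathcal D\subset\mathcal TM$ (non-empty, open, invariant under scaling by positive reals, $\pi(\mathcal D)=M$, each fibre $\mathcal D_x$ connected), positively 1-homogeneous in $y$, whose form $dd_J(\frac12(\cdot)^2)$ has maximal rank. For the conic pseudo-Finsler structure $\widehat F$, the energy $\widehat E=\frac12\widehat F^2$, metric tensor $\widehat g$, supporting form $\widehat\ell$, angular metric tensor $\widehat\hbar$, geodesic spray $\widehat G$, Barthel connection $\widehat\Gamma$, projectors $\widehat h,\widehat v$, horizontal map $\widehat\beta$, Berwald connection $\widehat D^\circ$, Cartan torsion $\widehat{\mathbf T}$ and Cartan connection $\widehat\nabla$ are defined on $\mathcal D$ by the same formulas as the corresponding unhatted objects of $F$. *)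

(* Defs.v *)
From mathcomp Require Import all_boot all_order all_algebra.
From mathcomp Require Import all_classical all_reals all_analysis.
Set Implicit Arguments.
Unset Strict Implicit.
Unset Printing Implicit Defensive.
Import Order.TTheory GRing.Theory Num.Theory.
Import numFieldNormedType.Exports.
Local Open Scope classical_set_scope.
Local Open Scope ring_scope.

Section Atlas.
Variables (R : realType) (V : normedModType R) (M : Type).

(* [f] is of class C^k on the open set [S]; the spaces used below are finite
   dimensional, so it is enough to ask for directional derivatives. *)
Fixpoint Ck (W : normedModType R) (k : nat) (S : set V) (f : V -> W) : Prop :=
  match k with
  | 0 => forall u, S u -> {for u, continuous f}
  | k'.+1 => (forall u, S u -> differentiable f u) /\
             forall v, Ck k' S (fun u => 'D_v f u)
  end.

Definition smooth (W : normedModType R) (S : set V) (f : V -> W) : Prop :=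
  forall k, Ck k S f.

(* [dom c] and [coord c] are the domain and the coordinate map of the chart
   [c]; [chart_at x] is a preferred chart around [x].  Only the raw data are
   recorded here, their compatibility is required in [smooth_manifold]. *)
Record atlas := Atlas {
  chart : Type;
  dom : chart -> set M;
  coord : chart -> M -> V;
  chart_at : M -> chart }.

Variable A : atlas.
Implicit Types (c : chart A) (x : M).

(* Local representative f o (coord c)^-1, extended by 0 outside the image of
   the chart. *)
Definition lrep (W : normedModType R) c (f : M -> W) : V -> W :=
  fun u => xget 0 (f @` (dom c `&` coord c @^-1` [set u])).

(* A tangent vector at [x] is given by its components in the chart
   [chart_at x], so that V plays the role of the tangent space at [x] and a
   vector field is a function [M -> V].  [to_chart c x] gives the components
   in the chart [c] of such a vector, [of_chart c x] is the inverse. *)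
Definition to_chart c x (v : V) : V :=
  'D_v (lrep (chart_at A x) (coord c)) (coord (chart_at A x) x).

Definition of_chart c x (v : V) : V :=
  'D_v (lrep c (coord (chart_at A x))) (coord c x).

Definition atlas_open (U : set M) : Prop :=
  forall c, open (coord c @` (dom c `&` U)).

Definition Ck_on (W : normedModType R) k (U : set M) (f : M -> W) : Prop :=
  forall c, Ck k (coord c @` (dom c `&` U)) (lrep c f).

Definition smooth_on (W : normedModType R) (U : set M) (f : M -> W) : Prop :=
  forall k, Ck_on k U f.

Definition vrep (X : M -> V) c : V -> V := lrep c (fun x => to_chart c x (X x)).

Definition vector_field (U : set M) (X : M -> V) : Prop :=
  forall c, smooth (coord c @` (dom c `&` U)) (vrep X c).

Definition differential (f : M -> R) x (v : V) : R :=
  'D_v (lrep (chart_at A x) f) (coord (chart_at A x) x).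

Definition act (X : M -> V) (f : M -> R) x : R := differential f x (X x).

(* [X, Y]^i = X^j d_j Y^i - Y^j d_j X^i *)
Definition bracket (X Y : M -> V) x : V :=
  let c := chart_at A x in
  'D_(X x) (vrep Y c) (coord c x) - 'D_(Y x) (vrep X c) (coord c x).

(* The field with constant components in the chart around [x], and value [v]
   at [x]. *)
Definition const_field x (v : V) : M -> V := fun y => of_chart (chart_at A x) y v.

(* (d omega)_ij = d_i omega_j - d_j omega_i, without factor 1/2 *)
Definition ext_derivative (omega : M -> V -> R) x (v w : V) : R :=
  differential (fun y => omega y (const_field x w y)) x v -
  differential (fun y => omega y (const_field x v y)) x w.

End Atlas.

Arguments Ck {R V W} k S f.
Arguments atlas {R} V M.
Arguments dom {R V M a} c _ /.
Arguments coord {R V M a} c _.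
Arguments chart_at {R V M} a _.

Definition paracompact (T : topologicalType) : Prop :=
  forall C : set (set T),
    (forall U, C U -> open U) -> \bigcup_(U in C) U = setT ->
    exists D : set (set T),
      [/\ forall U, D U -> open U /\ exists2 W, C W & U `<=` W,
          \bigcup_(U in D) U = setT &
          forall x : T, exists2 N, nbhs x N &
            finite_set [set U | D U /\ U `&` N !=set0]].

Record smooth_manifold (R : realType) (n : nat) (M : topologicalType)
    (A : atlas 'rV[R]_n M) : Prop := SmoothManifold {
  manifold_hausdorff : hausdorff_space M;
  manifold_paracompact : paracompact M;
  chart_cover : forall x, dom (chart_at A x) x;
  chart_open : forall c : chart A, open (dom c);
  chart_inj : forall c : chart A, {in dom c &, injective (coord c)};
  (* coord c is a homeomorphism from dom c onto an open subset of R^n *)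
  chart_homeo : forall (c : chart A) (U : set M), U `<=` dom c ->
    (open U <-> open (coord c @` U));
  chart_compat : forall c d : chart A,
    smooth (coord c @` (dom c `&` dom d)) (lrep c (coord d)) }.

(* The total space TM.  Its topology is the one defined by [tangent_atlas]
   (see [atlas_open]). *)
Record tangent (R : realType) (V : normedModType R) (M : Type)
    (A : atlas V M) := Tangent { base : M; fibre : V }.

Definition tangent_atlas (R : realType) (V : normedModType R) (M : Type)
    (A : atlas V M) : atlas (V * V)%type (tangent A) :=
  {| chart := chart A;
     dom := fun c p => dom c (base p);
     coord := fun c p => (coord c (base p), to_chart c (base p) (fibre p));
     chart_at := fun p => chart_at A (base p) |}.

Section Finsler.
Variables (R : realType) (n : nat) (M : Type) (A : atlas 'rV[R]_n M).

Local Notation V := ('rV[R]_n).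
Local Notation VV := ('rV[R]_n * 'rV[R]_n)%type.
Local Notation TM := (tangent A).
Local Notation TA := (tangent_atlas A).

(* Components at [p = (x, y)] of objects on TM refer to the coordinates
   (x^i, y^i) induced by [chart_at A x]: a pair (a, b) : VV stands for
   a^i d/dx^i + b^i d/dy^i, and w : V for a vector of the pullback bundle.
   In particular rho, gamma, J and eta have the expressions below. *)
Implicit Types (p : TM) (U : set TM) (E F : TM -> R) (G X : TM -> VV).

Definition slit : set TM := [set p | fibre p != 0].

Definition scale (t : R) p : TM := Tangent A (base p) (t *: fibre p).

Definition pi_vector_field U (W : TM -> V) : Prop :=
  forall c : chart A,
    smooth (coord (a := TA) c @` (dom (a := TA) c `&` U))
      (lrep (A := TA) c (fun p => to_chart c (base p) (W p))).

Definition rho (xi : VV) : V := xi.1.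
Definition gamma (w : V) : VV := (0, w).
Definition J (xi : VV) : VV := gamma (rho xi).
Definition eta p : V := fibre p.
Definition liouville p : VV := gamma (eta p).

(* inverse of gamma on vertical vectors *)
Definition gamma_inv (xi : VV) : V := xi.2.

Definition dJ (f : TM -> R) p (xi : VV) : R := differential TA f p (J xi).

Definition ddJ (f : TM -> R) p (xi zeta : VV) : R :=
  ext_derivative TA (dJ f) p xi zeta.

(* rank of the matrix of a bilinear form in the basis d/dx^i, d/dy^i *)
Definition VV_basis (i : 'I_(n + n)) : VV :=
  (lsubmx (delta_mx 0 i), rsubmx (delta_mx 0 i)).

Definition form_rank (omega : VV -> VV -> R) : nat :=
  \rank (\matrix_(i, j) omega (VV_basis i) (VV_basis j)).

Definition maximal_rank (omega : VV -> VV -> R) : Prop :=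
  form_rank omega = (n + n)%N.

Definition energy F p : R := 2^-1 * F p ^+ 2.

Record finsler F : Prop := Finsler_ {
  finsler_ge0 : forall p, 0 <= F p;
  finsler_smooth : smooth_on TA slit F;
  finsler_continuous : Ck_on TA 0 setT F;
  finsler_homogeneous : forall t p, 0 < t -> F (scale t p) = t * F p;
  finsler_rank : forall p, slit p -> maximal_rank (ddJ (energy F) p) }.

Record conic_subbundle (D : set TM) : Prop := ConicSubbundle {
  conic_slit : D `<=` slit;
  conic_nonempty : D !=set0;
  conic_open : atlas_open TA D;
  conic_scale : forall t p, 0 < t -> D p -> D (scale t p);
  conic_base : (@base _ _ _ A) @` D = setT;
  conic_connected : forall x, connected [set y | D (Tangent A x y)] }.

Record conic_pseudo_finsler (D : set TM) F : Prop := ConicPseudoFinsler {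
  cpf_domain : conic_subbundle D;
  cpf_ge0 : forall p, D p -> 0 <= F p;
  cpf_smooth : smooth_on TA D F;
  cpf_homogeneous : forall t p, 0 < t -> D p -> F (scale t p) = t * F p;
  cpf_rank : forall p, D p -> maximal_rank (ddJ (energy F) p) }.

(* g(rho W, rho Z) = dd_JE(JW, Z), with the lift Z = (b, 0) of b = rho Z; the
   choice of the lift is immaterial since dd_JE(JW, JZ) = 0. *)
Definition metric F p (a b : V) : R := ddJ (energy F) p (gamma a) (b, 0).

Definition supporting F p (a : V) : R := (F p)^-1 * metric F p (eta p) a.

Definition angular F p (a b : V) : R :=
  metric F p a b - supporting F p a * supporting F p b.

Record geodesic_spray (D : set TM) F G : Prop := GeodesicSpray {
  spray_field : vector_field TA D G;
  spray_J : forall p, D p -> J (G p) = liouville p;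
  spray_homogeneous : forall p, D p -> bracket TA liouville G p = G p;
  spray_energy : forall p xi, D p ->
    ddJ (energy F) p (G p) xi = - differential TA (energy F) p xi }.

(* [J, G] on vector fields, and its value on a tangent vector *)
Definition barthel_field G X p : VV :=
  bracket TA (fun q => J (X q)) G p - J (bracket TA X G p).

Definition barthel G p (xi : VV) : VV := barthel_field G (const_field TA p xi) p.

Definition hproj G p (xi : VV) : VV := 2^-1 *: (xi + barthel G p xi).
Definition vproj G p (xi : VV) : VV := 2^-1 *: (xi - barthel G p xi).

(* beta p w is the element of Im (hproj G p) sent to w by rho. *)
Definition beta G p (w : V) : VV :=
  xget 0 [set xi | range (hproj G p) xi /\ rho xi = w].

Definition vert (W : TM -> V) : TM -> VV := fun p => gamma (W p).
Definition hor G (W : TM -> V) : TM -> VV := fun p => beta G p (W p).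

(* D_{beta Z} W, from  gamma D_{hX} (rho Y) = v [hX, JY] *)
Definition berwald_h G (Z W : TM -> V) p : V :=
  gamma_inv (vproj G p (bracket TA (hor G Z) (vert W) p)).

(* D_{gamma Z} W = rho [gamma Z, beta W] *)
Definition berwald_v G (Z W : TM -> V) p : V :=
  rho (bracket TA (vert Z) (hor G W) p).

(* D_{gamma Z} f on functions *)
Definition berwald_v_fun (Z : TM -> V) (f : TM -> R) p : R :=
  act TA (vert Z) f p.

(* (D_{gamma Z} B)(W, Y) for a (0, 2)-tensor B *)
Definition berwald_v_tensor G (Z : TM -> V) (B : TM -> V -> V -> R)
    (W Y : TM -> V) p : R :=
  berwald_v_fun Z (fun q => B q (W q) (Y q)) p
  - B p (berwald_v G Z W p) (Y p) - B p (W p) (berwald_v G Z Y p).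

Definition cartan_torsion F G (W Y Z : TM -> V) p : R :=
  2^-1 * berwald_v_tensor G Z (metric F) W Y p.

(* Sections over all open subsets [U] of the slit bundle are used, a
   connection being a local operator. *)
Record cartan_connection F G (nabla : (TM -> VV) -> (TM -> V) -> TM -> V)
    : Prop := CartanConnection {
  cartan_v : forall U (X Y Z : TM -> V),
    atlas_open TA U -> U `<=` slit ->
    pi_vector_field U X -> pi_vector_field U Y -> pi_vector_field U Z ->
    forall p, U p ->
    2 * metric F p (nabla (vert X) Y p) (Z p) =
      act TA (vert X) (fun q => metric F q (Y q) (Z q)) p
      + metric F p (Y p) (rho (bracket TA (hor G Z) (vert X) p))
      + metric F p (Z p) (rho (bracket TA (vert X) (hor G Y) p));
  cartan_h : forall U (X Y Z : TM -> V),
    atlas_open TA U -> U `<=` slit ->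
    pi_vector_field U X -> pi_vector_field U Y -> pi_vector_field U Z ->
    forall p, U p ->
    2 * metric F p (nabla (hor G X) Y p) (Z p) =
      act TA (hor G X) (fun q => metric F q (Y q) (Z q)) p
      + act TA (hor G Y) (fun q => metric F q (Z q) (X q)) p
      - act TA (hor G Z) (fun q => metric F q (X q) (Y q)) p
      - metric F p (X p) (rho (bracket TA (hor G Y) (hor G Z) p))
      + metric F p (Y p) (rho (bracket TA (hor G Z) (hor G X) p))
      + metric F p (Z p) (rho (bracket TA (hor G X) (hor G Y) p)) }.

Record concurrent G (nabla : (TM -> VV) -> (TM -> V) -> TM -> V)
    (phi : TM -> V) : Prop := Concurrent {
  concurrent_field : pi_vector_field slit phi;
  concurrent_neq0 : forall p, slit p -> phi p != 0;
  concurrent_eqs : forall U (W : TM -> V),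
    atlas_open TA U -> U `<=` slit -> pi_vector_field U W ->
    forall p, U p ->
    [/\ nabla (hor G W) phi p = - W p, berwald_h G W phi p = - W p,
        nabla (vert W) phi p = 0 & berwald_v G W phi p = 0] }.

End Finsler.

(* Main.v *)
Require Import Defs.
From mathcomp Require Import all_boot all_order all_algebra.
From mathcomp Require Import all_classical all_reals all_analysis.
From mathcomp Require Import ring lra.
Set Implicit Arguments.
Unset Strict Implicit.
Unset Printing Implicit Defensive.
(* Again after MathComp, whose [coord] would otherwise hide that of [Defs]. *)
Import Defs.
Import Order.TTheory GRing.Theory Num.Theory.
Import numFieldNormedType.Exports.
Local Open Scope classical_set_scope.
Local Open Scope ring_scope.

(* Everything in the formula is vertical, so it can be computed in one tangent
   space T_xM, written in the chart chosen at x: there g(a, b) = D_a D_b (F^2/2),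
   and the Berwald derivative D_(gamma Z) is the ordinary directional derivative
   D_Z, whichever spray defines it.  The v-part of the Cartan connection, applied
   to the concurrent field and to fields that are constant in the fibre, says
   that the components phi_a do not depend on y; hence D_a Phi = phi_a.
   Differentiating F^4 / (2 (F - Phi)^2) twice expresses the metric of Fhat
   through g, phi and ell = dF.  A third differentiation, with
   D_Z ell(W) = hbar(W, Z) / F + ell(D_Z W), gives the torsion. *)

(** * Directional derivatives *)

(** Components at a point refer to [chart_at] of its base point. This chart may jump from one base
    point to the next but is the same all along a fibre, so vertical derivatives involve no change
    of chart. Transition maps come in for the smoothness of test fields and for the terms of
    brackets and exterior derivatives that leave the fibre; those terms either vanish or are
    determined by JG = C. The order of differentiation matters at one place: hbar(W, Z) contains D_W
    D_Z F, whereas differentiating ell(W) = D_W F along Z yields D_Z D_W F. Since [Ck] is phrased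
    with directional derivatives, the symmetry of second derivatives is derived from that
    definition, by second differences. *)

Section Calculus.
Variable R : realType.
Implicit Types U V W : normedModType R.

(** The differential of [f] satisfies the first-order expansion of [g] at [a] too, so uniqueness
    identifies it with the differential of [g]. *)
Lemma near_eq_differentiable V W (f g : V -> W) a :
  (\near a, f a = g a) -> differentiable f a -> differentiable g a.
Proof.
move=> fg df.
have H : continuous ('d f a) /\ g \o shift a = cst (g a) + 'd f a +o_ 0 id.
  split; first exact: diff_continuous.
  apply/eqaddoP => _/posnumP[e].
  have [_ /eqaddoP /(_ e%:num) /(_ [gt0 of e%:num])] := (diff_locallyP _ _).1 df.
  apply: filter_app; near=> h.
  rewrite !fctE /= -(nbhs_singleton fg).
  have -> // : f (h + a) = g (h + a).
  near: h; move: fg; rewrite (near_shift 0 a) /=.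
  by apply: filter_app; near=> z => /=; rewrite subr0.
by apply/diff_locallyP; rewrite (diff_unique H.1 H.2).
Unshelve. all: by end_near. Qed.

Lemma open_near V (S : set V) (P : V -> Prop) u :
  open S -> S u -> (forall z, S z -> P z) -> \near u, P u.
Proof.
by move=> oS Su SP; apply: filterS SP _; apply: open_nbhs_nbhs; split.
Qed.

Lemma open_eq_derive V W (S : set V) (f g : V -> W) u v :
  open S -> S u -> (forall z, S z -> f z = g z) -> 'D_v f u = 'D_v g u.
Proof. by move=> oS Su fg; apply: near_eq_derive; exact: open_near fg. Qed.

Lemma open_eq_differentiable V W (S : set V) (f g : V -> W) u :
  open S -> S u -> (forall z, S z -> f z = g z) ->
  differentiable f u -> differentiable g u.
Proof. by move=> oS Su fg; apply: near_eq_differentiable; exact: open_near fg. Qed.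

Lemma differentiable_fst V W (p : V * W) : differentiable (@fst V W) p.
Proof. by apply: (@linear_differentiable _ _ _ (@fst V W)) => q; exact: cvg_fst. Qed.

Lemma differentiable_snd V W (p : V * W) : differentiable (@snd V W) p.
Proof. by apply: (@linear_differentiable _ _ _ (@snd V W)) => q; exact: cvg_snd. Qed.

Lemma derive_fst V W (p v : V * W) : 'D_v (@fst V W) p = v.1.
Proof.
rewrite deriveE; last exact: differentiable_fst.
by rewrite (@diff_lin _ _ _ (@fst V W)) // => q; exact: cvg_fst.
Qed.

Lemma derive_snd V W (p v : V * W) : 'D_v (@snd V W) p = v.2.
Proof.
rewrite deriveE; last exact: differentiable_snd.
by rewrite (@diff_lin _ _ _ (@snd V W)) // => q; exact: cvg_snd.
Qed.

Lemma derive_comp U V W (f : U -> V) (g : V -> W) u v :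
  differentiable f u -> differentiable g (f u) ->
  'D_v (g \o f) u = 'D_('D_v f u) g (f u).
Proof.
move=> df dg; rewrite (deriveE _ dg) (deriveE _ df).
by rewrite (deriveE _ (differentiable_comp df dg)) diff_comp.
Qed.

Lemma derive_pair U V W (f : U -> V) (g : U -> W) u v :
  differentiable f u -> differentiable g u ->
  'D_v (fun z => (f z, g z)) u = ('D_v f u, 'D_v g u).
Proof.
move=> df dg; rewrite (deriveE _ dg) (deriveE _ df).
by rewrite (deriveE _ (differentiable_pair df dg)) diff_pair.
Qed.

Lemma differentiable_pairr V W (u : V) (v : W) :
  differentiable (fun w : W => (u, w)) v.
Proof. exact: (differentiable_pair (differentiable_cst u v)). Qed.

(* No differentiability is needed: this reads vertical derivatives in a fibre. *)
Lemma derive_lineE V V' W (f : V -> W) (g : V' -> W) u u' v v' :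
  (forall t : R, f (u + t *: v) = g (u' + t *: v')) -> 'D_v f u = 'D_v' g u'.
Proof.
move=> fg; rewrite /derive; set a := fun h => _; set b := fun h => _.
suff -> : a = b by []; apply/funext => h; rewrite /a /b /=.
rewrite (addrC (h *: v)) (addrC (h *: v')) fg.
by move: (fg 0); rewrite !scale0r !addr0 => ->.
Qed.

Lemma differentiable_direction V W (f : V -> W) u w :
  differentiable f u -> differentiable (fun v => 'D_v f u) w.
Proof.
move=> df; have -> : (fun v => 'D_v f u) = 'd f u.
  by apply/funext => v; exact: deriveE.
by apply: linear_differentiable; exact: diff_continuous.
Qed.

Lemma derive_direction V W (f : V -> W) u v w :
  differentiable f u -> 'D_v (fun z => 'D_z f u) w = 'D_v f u.
Proof.
move=> df; rewrite (deriveE v (differentiable_direction w df)) (deriveE v df).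
have -> : (fun v => 'D_v f u) = 'd f u by apply/funext => z; exact: deriveE.
by rewrite diff_lin //; exact: diff_continuous.
Qed.

Lemma deriveDl V W (f : V -> W) u v w (a : R) : differentiable f u ->
  'D_(a *: v + w) f u = a *: 'D_v f u + 'D_w f u.
Proof. by move=> df; rewrite !deriveE // linearP. Qed.

Lemma derive_row V n (f : V -> 'rV[R]_n) u v j : derivable f u v ->
  ('D_v f u) 0 j = 'D_v (fun z => f z 0 j) u.
Proof. by move=> df; rewrite derive_mx // mxE. Qed.

Lemma derive_basis W n (f : 'rV[R]_n -> W) u v : differentiable f u ->
  'D_v f u = \sum_(j < n) v 0 j *: 'D_(delta_mx 0 j) f u.
Proof.
move=> df; rewrite deriveE // {1}(row_sum_delta v) linear_sum.
by apply: eq_bigr => j _; rewrite linearZ deriveE.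
Qed.

End Calculus.

(** * Closure properties of maps of class C^k *)

Section Smoothness.
Variable R : realType.
Implicit Types U V W : normedModType R.

Lemma Ck_sub V W k (S T : set V) (f : V -> W) :
  S `<=` T -> Ck k T f -> Ck k S f.
Proof.
move=> ST; elim: k f => [|k IH] f /=; first by move=> cf u /ST; exact: cf.
by move=> [df Df]; split=> [u /ST|v]; [exact: df|exact: IH].
Qed.

Lemma Ck_eq V W k (S : set V) (f g : V -> W) :
  open S -> (forall u, S u -> f u = g u) -> Ck k S f -> Ck k S g.
Proof.
move=> oS; elim: k f g => [|k IH] f g fg /=.
  move=> cf u Su; have : f @ u --> f u by exact: cf.
  rewrite (fg u Su) => cfu.
  by apply: cvg_trans cfu; apply: near_eq_cvg; apply: open_near oS Su _ => z /fg.
move=> [df Df]; split=> [u Su|v].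
  exact: open_eq_differentiable oS Su fg (df _ Su).
by apply: IH (Df v) => u Su; exact: open_eq_derive fg.
Qed.

Lemma Ck_prev V W k (S : set V) (f : V -> W) : Ck k.+1 S f -> Ck k S f.
Proof.
elim: k f => [|k IH] f [df Df].
  by move=> u /df; exact: differentiable_continuous.
by split=> // v; apply: IH.
Qed.

Lemma Ck_cst V W k (S : set V) (w : W) : Ck k S (fun=> w).
Proof.
elim: k w => [|k IH] w; first by move=> u _; exact: cvg_cst.
split=> [u _|v]; first exact: differentiable_cst.
have -> : (fun u => 'D_v (fun=> w) u) = (fun=> 0 : W); last exact: IH.
by apply/funext => u; exact: derive_cst.
Qed.

Lemma smooth_linear V W (S : set V) (f : {linear V -> W}) :
  continuous f -> smooth S f.
Proof.
move=> cf [|k]; first by move=> u _; exact: cf.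
split=> [u _|v]; first exact: linear_differentiable.
have -> : (fun u => 'D_v f u) = (fun=> f v); last exact: Ck_cst.
apply/funext => u; rewrite deriveE; last exact: linear_differentiable.
by rewrite diff_lin.
Qed.

Lemma CkD V W k (S : set V) (f g : V -> W) : open S ->
  Ck k S f -> Ck k S g -> Ck k S (f + g).
Proof.
move=> oS; elim: k f g => [|k IH] f g /=.
  by move=> cf cg u Su; apply: continuousD; [exact: cf|exact: cg].
move=> [df Df] [dg Dg]; split=> [u Su|v].
  by apply: differentiableD; [exact: df|exact: dg].
apply: (Ck_eq oS _ (IH _ _ (Df v) (Dg v))) => u Su.
by rewrite deriveD //; apply: diff_derivable; [exact: df|exact: dg].
Qed.

Lemma Ck_sum V W k (S : set V) n (f : 'I_n -> V -> W) : open S ->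
  (forall i, Ck k S (f i)) -> Ck k S (\sum_(i < n) f i).
Proof.
move=> oS cf; elim/big_ind: _ => // [|g h cg ch]; first exact: Ck_cst.
exact: CkD.
Qed.

Lemma CkM V k (S : set V) (f g : V -> R) : open S ->
  Ck k S f -> Ck k S g -> Ck k S (f * g).
Proof.
move=> oS; elim: k f g => [|k IH] f g.
  by move=> cf cg u Su; apply: continuousM; [exact: cf|exact: cg].
move=> Cf Cg; have := (Ck_prev Cf, Ck_prev Cg) => -[cf cg].
case: Cf Cg => [df Df] [dg Dg]; split=> [u Su|v].
  by apply: differentiableM; [exact: df|exact: dg].
apply: (Ck_eq oS _ (CkD oS (IH _ _ cf (Dg v)) (IH _ _ cg (Df v)))) => u Su.
by rewrite deriveM //; apply: diff_derivable; [exact: df|exact: dg].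
Qed.

Lemma CkZl V W k (S : set V) (f : V -> R) (w : W) : open S ->
  Ck k S f -> Ck k S (fun u => f u *: w).
Proof.
move=> oS; elim: k f => [|k IH] f /=.
  by move=> cf u Su; apply: continuousZl; exact: cf.
move=> [df Df]; split=> [u Su|v]; first by apply: differentiableZl; exact: df.
apply: (Ck_eq oS _ (IH _ (Df v))) => u Su.
rewrite (deriveE _ (df u Su)) (deriveE _ (differentiableZl w (df u Su))).
by rewrite (diffZl w (df u Su)).
Qed.

Lemma Ck_entry V n k (S : set V) (f : V -> 'rV[R]_n) j : open S ->
  Ck k S f -> Ck k S (fun u => f u 0 j).
Proof.
move=> oS; elim: k f => [|k IH] f /=.
  by move=> cf u Su; apply: (@continuous_comp _ _ _ f (fun N : 'rV[R]_n => N 0 j));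
    [exact: cf|exact: coord_continuous].
move=> [df Df]; split=> [u Su|v].
  apply: (differentiable_comp (g := fun N : 'rV[R]_n => N 0 j)).
    exact: df.
  exact: differentiable_coord.
apply: (Ck_eq oS _ (IH _ (Df v))) => u Su.
by rewrite derive_row //; apply: diff_derivable; exact: df.
Qed.

Lemma Ck_snd U V W k (S : set U) (f : U -> V * W) : open S ->
  Ck k S f -> Ck k S (fun u => (f u).2).
Proof.
move=> oS; elim: k f => [|k IH] f.
  move=> cf u Su; apply: (@continuous_comp _ _ _ f (@snd V W)); first exact: cf.
  exact: differentiable_continuous (differentiable_snd _).
move=> [df Df]; split=> [u Su|v].
  exact: (differentiable_comp (g := @snd V W) (df u Su) (differentiable_snd _)).
apply: (Ck_eq oS _ (IH _ (Df v))) => u Su; rewrite -(derive_snd (f u)).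
exact: esym (derive_comp (g := @snd V W) v (df u Su) (differentiable_snd _)).
Qed.

Lemma Ck_row V n k (S : set V) (f : V -> 'rV[R]_n) : open S ->
  (forall j, Ck k S (fun u => f u 0 j)) -> Ck k S f.
Proof.
move=> oS cf; have -> : f = \sum_(j < n) (fun z => f z 0 j *: delta_mx 0 j).
  by apply/funext => z; rewrite fct_sumE [LHS]row_sum_delta.
by apply: Ck_sum => // j; exact: CkZl.
Qed.

Lemma Ck_contract U n k (S : set U) (h : 'I_n -> U -> R) (w : U -> 'rV[R]_n) :
  open S -> (forall j, Ck k S (h j)) -> Ck k S w ->
  Ck k S (fun u => \sum_(j < n) w u 0 j * h j u).
Proof.
move=> oS ch cw.
have -> : (fun u => \sum_(j < n) w u 0 j * h j u) =
    \sum_(j < n) (fun u => w u 0 j * h j u); last first.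
  by apply: Ck_sum => // j; exact: (CkM oS (Ck_entry j oS cw) (ch j)).
by apply/funext => u; rewrite fct_sumE.
Qed.

(** The chain rule differentiates [g] in the moving direction ['D_v f u], while [Ck] controls fixed
    directions only. Expanding in the basis of the row space turns this into a sum of products,
    which [Ck_contract] and the induction hypothesis handle. *)
Lemma Ck_comp_scalar U n k (S : set U) (T : set 'rV[R]_n)
    (f : U -> 'rV[R]_n) (g : 'rV[R]_n -> R) :
  open S -> (forall u, S u -> T (f u)) ->
  Ck k S f -> Ck k T g -> Ck k S (g \o f).
Proof.
move=> oS ST; elim: k f g ST => [|k IH] f g ST.
  move=> cf cg u Su; apply: continuous_comp; first exact: cf.
  by apply: cg; exact: ST.
move=> Cf [dg Dg]; have cf := Ck_prev Cf; case: Cf => df Df; split=> [u Su|v].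
  by apply: differentiable_comp; [exact: df|apply: dg; exact: ST].
have := Ck_contract oS (fun j => IH _ _ ST cf (Dg (delta_mx 0 j))) (Df v).
apply: Ck_eq => // u Su; have dgu := dg _ (ST u Su).
by rewrite (derive_comp _ (df u Su) dgu) (derive_basis _ dgu).
Qed.

Lemma Ck_comp U m n k (S : set U) (T : set 'rV[R]_m)
    (f : U -> 'rV[R]_m) (g : 'rV[R]_m -> 'rV[R]_n) :
  open S -> open T -> (forall u, S u -> T (f u)) ->
  Ck k S f -> Ck k T g -> Ck k S (g \o f).
Proof.
move=> oS oT ST cf cg; apply: Ck_row => // j.
by apply: (Ck_comp_scalar (g := fun z => g z 0 j) oS ST cf); exact: Ck_entry.
Qed.

(** Here the direction [l v] produced by the chain rule is fixed, so no basis of [V] is called for.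
    This covers the slices [v |-> (u, v)], whose target is a product and not a row space. *)
Lemma Ck_affine U V W k (S : set U) (T : set V) (f : U -> V) (l : U -> V)
    (g : V -> W) :
  open S -> (forall u, S u -> T (f u)) -> (forall u, differentiable f u) ->
  (forall u v, 'D_v f u = l v) -> Ck k T g -> Ck k S (g \o f).
Proof.
move=> oS ST df Df; elim: k g => [|k IH] g.
  move=> cg u Su; apply: continuous_comp; last by apply: cg; exact: ST.
  exact: differentiable_continuous.
move=> [dg Dg]; split=> [u Su|v].
  by apply: differentiable_comp => //; apply: dg; exact: ST.
apply: (Ck_eq oS _ (IH _ (Dg (l v)))) => u Su.
by rewrite (derive_comp _ (df u) (dg _ (ST u Su))) Df.
Qed.

Lemma Ck_slice U V W k (S : set (U * V)) (f : U * V -> W) (u : U) (T : set V) :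
  open T -> (forall v, T v -> S (u, v)) ->
  Ck k S f -> Ck k T (fun v => f (u, v)).
Proof.
move=> oT TS; apply: (Ck_affine (f := fun v => (u, v)) (l := fun v => (0, v))) => //.
move=> v w; rewrite (derive_pair _ (differentiable_cst u v)) //.
by rewrite derive_cst derive_id.
Qed.

(** Differentiation along a moving direction costs one order; it yields the smoothness of tangent
    maps [(x, y) |-> D_y tau (x)] of transitions. *)
Lemma Ck_derive_along U m n k (S : set U) (T : set 'rV[R]_m)
    (f : 'rV[R]_m -> 'rV[R]_n) (u w : U -> 'rV[R]_m) :
  open S -> open T -> (forall s, S s -> T (u s)) ->
  Ck k S u -> Ck k S w -> Ck k.+1 T f -> Ck k S (fun s => 'D_(w s) f (u s)).
Proof.
move=> oS oT ST cu cw [df Df]; apply: Ck_row => // i.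
have := Ck_contract oS (fun j => Ck_entry i oS
  (Ck_comp oS oT ST cu (Df (delta_mx 0 j)))) cw.
apply: Ck_eq => // s Ss; rewrite (derive_basis _ (df _ (ST _ Ss))) summxE.
by apply: eq_bigr => j _; rewrite mxE.
Qed.

End Smoothness.

(** * Symmetry of second derivatives *)

Section Schwarz.
Variables (R : realType) (V : normedModType R) (O : set V).
Hypothesis oO : open O.

(** The second difference is the increment over [0, t] of [k s = f (sa + tb + y) - f (sa + y)]. The
    mean value theorem rewrites it as t times a difference of two values of [u = 'D_a f], and the
    first-order expansion of [u] at [y] estimates that difference. *)
Lemma second_difference (f : V -> R) y a b : O y -> Ck 2 O f ->
  forall e, 0 < e -> exists2 d, 0 < d & forall t, 0 < t < d ->
  `|f (t *: a + t *: b + y) - f (t *: a + y) - f (t *: b + y) + f y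
    - t ^+ 2 * 'D_b ('D_a f) y| <= e * t ^+ 2.
Proof.
move=> Oy [df Df] e e0; pose u := 'D_a f; have [du _] := Df a.
(* t * N bounds both |sa| and |sa + tb| for s in [0, t]; the summand 1 keeps N positive when a = b =
   0. *)
set N := `|a| + `|b| + 1.
have N0 : 0 < N by rewrite /N ltr_wpDl // addr_ge0.
(* Two remainders of [u] occur, each at most e / (2N) * tN = e t / 2; the factor t of the mean value
   theorem then gives e t^2. *)
have : \forall h \near 0, O (h + y) /\
    `|u (h + y) - u y - 'd u y h| <= e / (2 * N) * `|h|.
  apply: filterI.
    have : \forall h \near y, O h by apply: open_nbhs_nbhs; split.
    rewrite (near_shift 0 y) /=; apply: filter_app; near=> z => /=.
    by rewrite subr0.
  have [_ /eqaddoP] := (diff_locallyP _ _).1 (du _ Oy).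
  move=> /(_ (e / (2 * N))); rewrite divr_gt0 ?mulr_gt0 // => /(_ isT).
  by apply: filter_app; near=> h; rewrite !fctE /= opprD addrA.
move=> /nbhs_normP [d /= d0 Hd].
have {}Hd h : `|h| < d -> O (h + y) /\
    `|u (h + y) - u y - 'd u y h| <= e / (2 * N) * `|h|.
  by move=> hd; apply: Hd; rewrite /= sub0r normrN.
exists (d / N); first exact: divr_gt0.
move=> t /andP[t0]; rewrite ltr_pdivlMr // => tN.
have sh s : 0 <= s <= t -> `|s *: a| <= t * N /\ `|s *: a + t *: b| <= t * N.
  move=> /andP[s0 st]; have sa : `|s *: a| <= t * `|a|.
    by rewrite normrZ ger0_norm // ler_wpM2r.
  have tb : `|t *: b| = t * `|b| by rewrite normrZ gtr0_norm.
  have tb0 : 0 <= t * `|b| by rewrite mulr_ge0 // ltW.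
  split; first by rewrite /N !mulrDr mulr1; lra.
  by apply: le_trans (ler_normD _ _) _; rewrite tb /N !mulrDr mulr1; lra.
pose k s := f (s *: a + t *: b + y) - f (s *: a + y).
have dk s : 0 <= s <= t ->
    is_derive s 1 k (u (s *: a + t *: b + y) - u (s *: a + y)).
  move=> /sh [s1 s2].
  have [S1 _] := Hd _ (le_lt_trans s1 tN).
  have [S2 _] := Hd _ (le_lt_trans s2 tN).
  have line (w : V) : O (s *: a + w) ->
      is_derive s 1 (fun r : R => f (r *: a + w)) (u (s *: a + w)).
    move=> Ow; have dl : differentiable (fun r : R => r *: a + w) s.
      have da : differentiable ( *:%R^~ a : R -> V) s by [].
      exact (differentiableD da (differentiable_cst w s)).
    have dfl := differentiable_comp dl (df _ Ow).
    split; first exact: (diff_derivable dfl).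
    apply: (@derive_lineE _ _ _ _ _ f) => r.
    by rewrite /= [r *: 1]mulr1 scalerDl addrAC.
  apply: is_deriveB; last exact: line.
  by under eq_fun do rewrite -addrA; rewrite -addrA; apply: line; rewrite addrA.
have [||c /[!in_itv] /= /andP[c0 ct] kc] :=
  @MVT R k (fun s => u (s *: a + t *: b + y) - u (s *: a + y)) 0 t t0.
- by move=> s /[!in_itv] /= /andP[s0 st]; apply: dk; rewrite !ltW.
- apply: derivable_within_continuous => s /[!in_itv] /= st.
  by have [] := dk s st.
have ct' : 0 <= c <= t by rewrite !ltW.
have [s1 s2] := sh c ct'.
have [_ H1] := Hd _ (le_lt_trans s1 tN).
have [_ H2] := Hd _ (le_lt_trans s2 tN).
have -> : f (t *: a + t *: b + y) - f (t *: a + y) - f (t *: b + y) + f y = k t - k 0.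
  by rewrite /k scale0r !add0r; ring.
rewrite kc subr0 deriveE //; last exact: du.
set r1 := _ - _ - _ in H1; set r2 := _ - _ - _ in H2.
have -> : (u (c *: a + t *: b + y) - u (c *: a + y)) * t - t ^+ 2 * 'd u y b =
    (r2 - r1) * t.
  have db : 'd u y (t *: b) = t * 'd u y b by exact: linearZ.
  by rewrite /r1 /r2 linearD db /=; ring.
rewrite normrM (gtr0_norm t0) expr2 mulrA ler_pM2r //.
apply: le_trans (ler_normB _ _) _.
have c0' : 0 <= e / (2 * N) by rewrite divr_ge0 ?mulr_ge0 // ltW.
have B1 := le_trans H1 (ler_wpM2l c0' s1).
have B2 := le_trans H2 (ler_wpM2l c0' s2).
apply: le_trans (lerD B2 B1) _.
rewrite le_eqVlt; apply/orP; left; apply/eqP.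
by field; rewrite gt_eqF.
Unshelve. all: by end_near. Qed.

(** The second difference is symmetric in [a] and [b], so t^2 times the gap between the two mixed
    derivatives is a difference of two remainders, each at most (e / 2) t^2. *)
Lemma derive_comm (f : V -> R) y a b : O y -> Ck 2 O f ->
  'D_a ('D_b f) y = 'D_b ('D_a f) y.
Proof.
move=> Oy cf; apply/eqP; rewrite -subr_eq0 -normr_le0.
apply/ler_addgt0Pl => e e0; rewrite addr0.
have [d1 d10 H1] := second_difference a b Oy cf (divr_gt0 e0 (ltr0Sn R 1)).
have [d2 d20 H2] := second_difference b a Oy cf (divr_gt0 e0 (ltr0Sn R 1)).
pose t := Num.min d1 d2 / 2.
have m0 : 0 < Num.min d1 d2 by rewrite lt_min d10.
have t0 : 0 < t by rewrite /t; lra.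
have tm : t < Num.min d1 d2 by rewrite /t; lra.
move: (tm); rewrite lt_min => /andP[t1 t2].
have := H1 t; rewrite t0 t1 => /(_ isT) {}H1.
have := H2 t; rewrite t0 t2 => /(_ isT) {}H2.
move: H2; rewrite (addrC (t *: b) (t *: a)) => H2.
have tt : 0 < t ^+ 2 by rewrite exprn_gt0.
rewrite -(ler_pM2l tt) -{1}(gtr0_norm tt) -normrM.
set A := 'D_a ('D_b f) y; set B := 'D_b ('D_a f) y in H1 *.
have -> : t ^+ 2 * (A - B) =
    (f (t *: a + t *: b + y) - f (t *: a + y) - f (t *: b + y) + f y - t ^+ 2 * B)
    - (f (t *: a + t *: b + y) - f (t *: b + y) - f (t *: a + y) + f y - t ^+ 2 * A).
  by ring.
apply: le_trans (ler_normB _ _) _; apply: le_trans (lerD H1 H2) _.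
by rewrite -mulrDl -splitr mulrC.
Qed.

End Schwarz.

(** * Derivative rules for real functions *)

Section PointwiseRules.
Variables (R : realType) (V : normedModType R) (y v : V).
Implicit Types f g : V -> R.

(** These rules are stated pointwise and with real products, so that the derivatives they assemble
    are expressions on which [ring] and [field] work. *)
Lemma is_derive_mul f g df dg : is_derive y v f df -> is_derive y v g dg ->
  is_derive y v (fun z => f z * g z) (f y * dg + g y * df).
Proof. by move=> Df Dg; exact: (is_deriveM (f := f) (g := g)). Qed.

Lemma is_derive_add f g df dg : is_derive y v f df -> is_derive y v g dg ->
  is_derive y v (fun z => f z + g z) (df + dg).
Proof. by move=> Df Dg; exact: (is_deriveD (f := f) (g := g)). Qed.

Lemma is_derive_sub f g df dg : is_derive y v f df -> is_derive y v g dg ->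
  is_derive y v (fun z => f z - g z) (df - dg).
Proof. by move=> Df Dg; exact: (is_deriveB (f := f) (g := g)). Qed.

Lemma is_derive_exp f n df : is_derive y v f df ->
  is_derive y v (fun z => f z ^+ n) (n%:R * f y ^+ n.-1 * df).
Proof.
move=> Df; have H := is_deriveX n Df; rewrite exprfctE in H; exact: H.
Qed.

Lemma is_derive_inv f df : f y != 0 -> is_derive y v f df ->
  is_derive y v (fun z => (f z)^-1) (- (f y) ^- 2 * df).
Proof.
by move=> fy [Df <-]; split; [exact: derivableV|rewrite deriveV].
Qed.

Lemma is_derive_const (c : R) : is_derive y v (fun=> c) 0.
Proof. exact: is_derive_cst. Qed.

Lemma open_is_derive (O : set V) f g df : open O -> O y ->
  (forall z, O z -> f z = g z) -> is_derive y v g df -> is_derive y v f df.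
Proof.
move=> oO Oy fg; apply: near_eq_is_derive.
by apply: (open_near oO Oy) => z Oz; rewrite fg.
Qed.

Lemma diff_is_derive f : differentiable f y -> is_derive y v f ('D_v f y).
Proof. by move=> df; exact: (derivableP (diff_derivable df)). Qed.

End PointwiseRules.

(** * Differentiation of a linear form along a moving vector *)

Section Forms.
Variables (R : realType) (n : nat) (O : set 'rV[R]_n).
Hypothesis oO : open O.
Local Notation V := 'rV[R]_n.

Definition linear_form (w : V -> V -> R) : Prop :=
  forall z t a b, O z -> w z (t *: a + b) = t * w z a + w z b.

Lemma linear_form_basis w z a : linear_form w -> O z ->
  w z a = \sum_(j < n) a 0 j * w z (delta_mx 0 j).
Proof.
move=> lw Oz; have w0 : w z 0 = 0.
  have := lw z 0 0 0 Oz; rewrite scale0r addr0 mul0r add0r => _.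
  have := lw z 1 0 0 Oz; rewrite scale1r addr0 mul1r => /eqP.
  by rewrite -subr_eq0 opprD addNKr oppr_eq0 => /eqP.
rewrite {1}(row_sum_delta a).
elim/big_rec2: _ => [|j x b _ <-]; [exact: w0|exact: lw].
Qed.

(** Differentiability is assumed only for the values of [w] on fixed vectors. Expanding [W z] in the
    basis reduces the claim to the product rule in each component; the last term keeps the vector
    frozen at [W y]. *)
Lemma linear_form_derive w (W : V -> V) y v :
  linear_form w -> O y -> (forall a, differentiable (w^~ a) y) ->
  differentiable W y ->
  differentiable (fun z => w z (W z)) y /\
  'D_v (fun z => w z (W z)) y = w y ('D_v W y) + 'D_v (w^~ (W y)) y.
Proof.
move=> lw Oy dw dW.
pose h j z := W z 0 j * w z (delta_mx 0 j).
have dWj j : differentiable (fun z => W z 0 j) y.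
  exact: (differentiable_comp (g := fun N : V => N 0 j) dW (differentiable_coord _ _ _)).
have dh j : differentiable (h j) y by exact: differentiableM.
have hE z : O z -> (\sum_(j < n) h j) z = w z (W z).
  by move=> Oz; rewrite fct_sumE (linear_form_basis (W z) lw Oz).
split.
  by apply: (open_eq_differentiable oO Oy hE); exact: differentiable_sum.
rewrite -(open_eq_derive v oO Oy hE) derive_sum; last first.
  by move=> j; exact: diff_derivable.
pose k j z := W y 0 j * w z (delta_mx 0 j).
have kE z : O z -> (\sum_(j < n) k j) z = w z (W y).
  by move=> Oz; rewrite fct_sumE (linear_form_basis (W y) lw Oz).
have dk j : derivable (k j) y v.
  by apply: diff_derivable; exact: (differentiableZ (W y 0 j) (dw _)).
rewrite -(open_eq_derive v oO Oy kE) derive_sum //.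
rewrite (linear_form_basis ('D_v W y) lw Oy) -big_split /=.
apply: eq_bigr => j _; rewrite (derive_row j (diff_derivable dW)).
rewrite (derive_val (is_derive := is_derive_mul (diff_is_derive v (dWj j))
  (diff_is_derive v (dw (delta_mx 0 j))))).
rewrite (derive_val (is_derive := is_derive_mul (is_derive_const y v (W y 0 j))
  (diff_is_derive v (dw (delta_mx 0 j))))).
by rewrite mulr0 addr0 addrC; congr (_ + _); exact: mulrC.
Qed.

End Forms.

(** * Calculus in a fibre *)

Section Minkowski.
Variables (R : realType) (n : nat) (O : set 'rV[R]_n) (F : 'rV[R]_n -> R).
Local Notation V := 'rV[R]_n.
Hypothesis oO : open O.
Hypothesis sF : smooth O F.

Let En (z : V) : R := 2^-1 * F z ^+ 2.
(** The metric is a parameter characterised by [gE], so that the restriction of [metric F] to a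
    fibre can be substituted for it; [ghat] below is treated alike. *)
Variable g : V -> V -> V -> R.
Hypothesis gE : forall z a b, g z a b = 'D_a ('D_b En) z.

Lemma diff_F y : O y -> differentiable F y.
Proof. by move=> Oy; exact: (sF 1%N).1. Qed.

Lemma diff_dF a y : O y -> differentiable ('D_a F) y.
Proof. by move=> Oy; exact: (((sF 2).2 a).1 _ Oy). Qed.

Lemma derive_half_square (f : V -> R) a y : differentiable f y ->
  'D_a (fun z => 2^-1 * f z ^+ 2) y = f y * 'D_a f y.
Proof.
move=> df; rewrite (derive_val (is_derive := is_derive_mul
  (is_derive_const y a (2^-1 : R)) (is_derive_exp 2 (diff_is_derive a df)))).
by rewrite mulr0 addr0 expr1 !mulrA mulVf ?mul1r // pnatr_eq0.
Qed.

Lemma energy_smooth : smooth O En.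
Proof.
move=> k; apply: (Ck_eq oO (f := (fun=> 2^-1) * (F * F))) => //.
by apply: (CkM oO (Ck_cst _ _ _)); exact: (CkM oO (sF k) (sF k)).
Qed.

Lemma hessianE y a b : O y ->
  g y a b = 'D_a F y * 'D_b F y + F y * 'D_a ('D_b F) y.
Proof.
move=> Oy; rewrite gE (@open_eq_derive _ _ _ O _ (fun z => F z * 'D_b F z)) //.
  rewrite (derive_val (is_derive := is_derive_mul (diff_is_derive a (diff_F Oy))
    (diff_is_derive a (diff_dF b Oy)))).
  by rewrite addrC mulrC.
by move=> z Oz; exact: derive_half_square (diff_F Oz).
Qed.

Lemma hessian_linear_l b : linear_form O (fun z a => g z a b).
Proof.
by move=> z t a c Oz; rewrite !gE; apply: deriveDl; exact: ((energy_smooth 2).2 b).1.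
Qed.

Lemma hessian_linear_r a : linear_form O (fun z b => g z a b).
Proof.
move=> z t b c Oz; rewrite !hessianE //.
have dD w : O w -> 'D_(t *: b + c) F w = t * 'D_b F w + 'D_c F w.
  by move=> Ow; exact: deriveDl (diff_F Ow).
rewrite (open_eq_derive a oO Oz dD) dD //.
rewrite (derive_val (is_derive := is_derive_add (is_derive_mul
  (is_derive_const z a t) (diff_is_derive a (diff_dF b Oz)))
  (diff_is_derive a (diff_dF c Oz)))).
move: ('D_a ('D_b F) z) ('D_a ('D_c F) z) => u v.
by move: ('D_a F z) ('D_b F z) ('D_c F z) (F z) => p q r s; ring.
Qed.

Lemma diff_hessian y a b : O y -> differentiable (fun z => g z a b) y.
Proof.
move=> Oy; have -> : (fun z => g z a b) = 'D_a ('D_b En) by apply/funext => z.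
exact: ((((energy_smooth 3).2 b).2 a).1 _ Oy).
Qed.

Lemma diff_hessian_along (W Y : V -> V) y : O y ->
  differentiable W y -> differentiable Y y ->
  differentiable (fun z => g z (W z) (Y z)) y.
Proof.
move=> Oy dW dY.
have lW : linear_form O (fun z b => g z (W z) b).
  by move=> z t a b Oz; exact: hessian_linear_r.
have dg b : differentiable (fun z => g z (W z) b) y.
  exact: (linear_form_derive oO 0 (hessian_linear_l b) Oy
    (fun a => diff_hessian a b Oy) dW).1.
exact: (linear_form_derive oO 0 lW Oy dg dY).1.
Qed.

Hypothesis homF : forall t y, 0 < t -> O y -> O (t *: y) /\ F (t *: y) = t * F y.

(** Moving from [y] in the direction [y] is moving along the ray through [y], and t > 0 is an open
    condition around t = 1. *)
Lemma derive_radial (f : V -> R) (h : R -> R) y :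
  (forall t, 0 < t -> f (t *: y) = h t) -> 'D_y f y = 'D_1 h 1.
Proof.
move=> fh; rewrite -(@open_eq_derive _ _ _ [set t : R | 0 < t]
  (fun t => f (t *: y)) h 1 1 (@open_gt _ _) ltr01 fh).
apply: derive_lineE => t.
by rewrite [t *: 1]mulr1 scalerDl scale1r.
Qed.

Lemma Euler y : O y -> 'D_y F y = F y.
Proof.
move=> Oy; rewrite (derive_radial (h := fun t => t * F y)); last first.
  by move=> t t0; have [] := homF t0 Oy.
rewrite (derive_val (is_derive := is_derive_mul (is_derive_id (1 : R) 1)
  (is_derive_const _ _ (F y)))).
by rewrite mulr0 add0r mulr1.
Qed.

Lemma dF_homogeneous t y a : 0 < t -> O y -> 'D_a F (t *: y) = 'D_a F y.
Proof.
move=> t0 Oy; have [Oty _] := homF t0 Oy.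
have dt : differentiable ( *:%R t : V -> V) y by [].
have tE : 'D_a ( *:%R t : V -> V) y = t *: a.
  by rewrite deriveE // diff_val.
have : 'D_a (F \o *:%R t) y = t * 'D_a F y.
  have <- : 'D_a (fun z => t * F z) y = t * 'D_a F y.
    rewrite (derive_val (is_derive := is_derive_mul (is_derive_const y a t)
      (diff_is_derive a (diff_F Oy)))).
    by rewrite mulr0 addr0.
  by apply: (open_eq_derive _ oO Oy) => z Oz; exact: (homF t0 Oz).2.
rewrite (derive_comp a dt (diff_F Oty)) tE -[t *: a]addr0 deriveDl; last exact: diff_F.
by rewrite derive0 addr0 => /(mulfI (lt0r_neq0 t0)).
Qed.

Lemma Euler_dF y a : O y -> 'D_y ('D_a F) y = 0.
Proof.
move=> Oy; rewrite (derive_radial (h := fun=> 'D_a F y)) ?derive_cst // => t t0.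
exact: dF_homogeneous.
Qed.

Variable vp : V -> V.
Hypothesis dvp : forall y, O y -> differentiable vp y.
Let phi (z a : V) : R := g z (vp z) a.
Let Phi (z : V) : R := phi z z.
Hypothesis phi_cst : forall y a b, O y -> 'D_b (phi^~ a) y = 0.
Hypothesis Phi_lt : forall y, O y -> Phi y < F y.

Lemma phi_linear : linear_form O phi.
Proof. by move=> z t a b Oz; exact: hessian_linear_r. Qed.

Lemma diff_phi y a : O y -> differentiable (phi^~ a) y.
Proof.
by move=> Oy; exact: diff_hessian_along (dvp Oy) (differentiable_cst a y).
Qed.

(** Of the two terms of the product rule, the one that differentiates the components of [phi]
    vanishes by [phi_cst]. *)
Lemma derive_phi_along (W : V -> V) y v : O y -> differentiable W y ->
  is_derive y v (fun z => phi z (W z)) (phi y ('D_v W y)).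
Proof.
move=> Oy dW.
have [dp pE] := linear_form_derive oO v phi_linear Oy (fun a => diff_phi a Oy) dW.
have {}pE : 'D_v (fun z => phi z (W z)) y = phi y ('D_v W y).
  apply: (etrans pE); apply: (etrans _ (addr0 _)).
  exact: (congr1 (fun t => phi y ('D_v W y) + t) (phi_cst (W y) v Oy)).
exact (DeriveDef (diff_derivable dp) pE).
Qed.

Lemma derive_Phi y v : O y -> is_derive y v Phi (phi y v).
Proof.
move=> Oy; have did : differentiable (id : V -> V) y by [].
by have := derive_phi_along v Oy did; rewrite derive_id.
Qed.

(* At a zero of F the Hessian of the energy is [dF * dF] and [D_y F = F = 0], so
   [Phi = 0], against [Phi < F]. *)
Lemma F_neq0 y : O y -> F y != 0.
Proof.
move=> Oy; apply/eqP => Fy0; have := Phi_lt Oy.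
by rewrite /Phi /phi hessianE // Euler // Fy0 mulr0 mul0r addr0 ltxx.
Qed.

Lemma F_Phi_neq0 y : O y -> F y - Phi y != 0.
Proof. by move=> Oy; rewrite gt_eqF // subr_gt0; exact: Phi_lt. Qed.

Lemma supportingE y a : O y -> (F y)^-1 * g y y a = 'D_a F y.
Proof.
move=> Oy; rewrite hessianE // Euler // Euler_dF // mulr0 addr0.
by rewrite mulKf //; exact: F_neq0.
Qed.

(** The parenthesis is hbar(W, v), which [hessianE] identifies with F times D_W D_v F. The product
    rule gives D_v D_W F, hence the appeal to [derive_comm]. *)
Lemma derive_dF_along (W : V -> V) y v : O y -> differentiable W y ->
  is_derive y v (fun z => 'D_(W z) F z)
    ((F y)^-1 * (g y (W y) v - 'D_(W y) F y * 'D_v F y) + 'D_('D_v W y) F y).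
Proof.
move=> Oy dW.
have lF : linear_form O (fun z a => 'D_a F z).
  by move=> z t a b Oz; exact: deriveDl (diff_F Oz).
have [dp pE] := linear_form_derive oO v lF Oy (fun a => diff_dF a Oy) dW.
have -> : (F y)^-1 * (g y (W y) v - 'D_(W y) F y * 'D_v F y) =
    'D_v ('D_(W y) F) y.
  rewrite (hessianE _ _ Oy) [X in X - _]addrC addrK (mulKf (F_neq0 Oy)).
  exact: (derive_comm oO (W y) v Oy (sF 2)).
by rewrite addrC -pE; exact: diff_is_derive.
Qed.

Let Fhat (z : V) : R := F z ^+ 2 / (F z - Phi z).
Variable ghat : V -> V -> V -> R.
Hypothesis ghatE : forall z a b,
  ghat z a b = 'D_a ('D_b (fun z => 2^-1 * Fhat z ^+ 2)) z.

(** Write d(Fhat^2 / 2) = A dF + B phi, where A = F^3 (F - 2 Phi) / (F - Phi)^3 and B = F^4 / (F -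
    Phi)^3 are the partial derivatives of F^4 / (2 (F - Phi)^2) in F and Phi. Since F Hess F = g -
    dF dF, the coefficient of g is c1 = A / F, and what remains for dF dF is c3 = dA/dF - A / F. The
    others are c2 = dB/dPhi, for phi phi, and c4 = dA/dPhi = dB/dF, for the mixed terms. *)
Let c1 (z : V) : R := F z ^+ 2 * (F z - 2 * Phi z) / (F z - Phi z) ^+ 3.
Let c2 (z : V) : R := 3 * F z ^+ 4 / (F z - Phi z) ^+ 4.
Let c3 (z : V) : R := F z ^+ 2 * Phi z * (4 * Phi z - F z) / (F z - Phi z) ^+ 4.
Let c4 (z : V) : R := F z ^+ 3 * (F z - 4 * Phi z) / (F z - Phi z) ^+ 4.

Lemma derive_energy_hat y b : O y ->
  'D_b (fun z => 2^-1 * Fhat z ^+ 2) y =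
  F y ^+ 3 * (F y - 2 * Phi y) / (F y - Phi y) ^+ 3 * 'D_b F y
  + F y ^+ 4 / (F y - Phi y) ^+ 3 * phi y b.
Proof.
move=> Oy; have k0 := F_Phi_neq0 Oy.
have dF := diff_is_derive b (diff_F Oy); have dP := derive_Phi b Oy.
have dH := is_derive_mul (is_derive_const y b (2^-1 : R)) (is_derive_exp 2
  (is_derive_mul (is_derive_exp 2 dF) (is_derive_inv (f := fun z => F z - Phi z) k0
    (is_derive_sub dF dP)))).
rewrite (derive_val (is_derive := dH)) /=; move: k0.
by move: (phi y b) ('D_b F y) (Phi y) (F y) => p q r s k0; field.
Qed.

Lemma hessian_hat y a b : O y ->
  ghat y a b = c1 y * g y a b + c2 y * (phi y a * phi y b)
    + c3 y * ('D_a F y * 'D_b F y)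
    + c4 y * (phi y a * 'D_b F y + phi y b * 'D_a F y).
Proof.
move=> Oy; have k0 := F_Phi_neq0 Oy; rewrite ghatE.
rewrite (open_eq_derive a oO Oy (fun z => derive_energy_hat b (y := z))).
have dF := diff_is_derive a (diff_F Oy); have dP := derive_Phi a Oy.
have dk := is_derive_inv (f := fun z => (F z - Phi z) ^+ 3)
  (expf_neq0 3 k0) (is_derive_exp 3 (is_derive_sub dF dP)).
have dH := is_derive_add
  (is_derive_mul (is_derive_mul (is_derive_mul (is_derive_exp 3 dF)
    (is_derive_sub dF (is_derive_mul (is_derive_const y a (2 : R)) dP))) dk)
    (diff_is_derive a (diff_dF b Oy)))
  (is_derive_mul (is_derive_mul (is_derive_exp 4 dF) dk)
    (diff_is_derive a (diff_phi b Oy))).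
(* [phi_cst] removes the derivative of [phi b], and [hessianE] expands [g], so that both sides are
   written with ['D_a ('D_b F) y]. *)
rewrite (derive_val (is_derive := dH)) /= phi_cst // hessianE // /c1 /c2 /c3 /c4.
move: k0 ('D_a ('D_b F) y) (phi y a) (phi y b) => k0 u p q.
by move: k0; move: ('D_a F y) ('D_b F y) (Phi y) (F y) => r s t w k0; field.
Qed.

(** Trades an explicit derivative for its name: the derivatives of the coefficients stay unexpanded,
    as in the torsion formula. *)
Lemma is_derive_self (f : V -> R) y v d :
  is_derive y v f d -> is_derive y v f ('D_v f y).
Proof. by case=> df _; exact: derivableP. Qed.

Let hb (z a b : V) : R := g z a b - 'D_a F z * 'D_b F z.

(** The product rule is applied to [hessian_hat] along W and Y. The terms with D_v W or D_v Y cancel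
    against the two that are subtracted, and the angular terms are what is left of the derivatives
    of ell(W) and ell(Y). *)
Lemma torsion_hat (W Y : V -> V) y v :
  O y -> differentiable W y -> differentiable Y y ->
  'D_v (fun z => ghat z (W z) (Y z)) y
    - ghat y ('D_v W y) (Y y) - ghat y (W y) ('D_v Y y) =
  c1 y * ('D_v (fun z => g z (W z) (Y z)) y
    - g y ('D_v W y) (Y y) - g y (W y) ('D_v Y y))
  + F y * Phi y * (4 * Phi y - F y) / (F y - Phi y) ^+ 4
    * (hb y (W y) v * 'D_(Y y) F y + hb y (Y y) v * 'D_(W y) F y)
  + F y ^+ 2 * (F y - 4 * Phi y) / (F y - Phi y) ^+ 4
    * (hb y (W y) v * phi y (Y y) + hb y (Y y) v * phi y (W y))
  + 'D_v c1 y * g y (W y) (Y y)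
  + ('D_v (fun z => c2 z * (phi z (W z) * phi z (Y z))) y
    - c2 y * (phi y ('D_v W y) * phi y (Y y))
    - c2 y * (phi y (W y) * phi y ('D_v Y y)))
  + 'D_v c3 y * ('D_(W y) F y * 'D_(Y y) F y)
  + 'D_v c4 y * (phi y (W y) * 'D_(Y y) F y + phi y (Y y) * 'D_(W y) F y).
Proof.
move=> Oy dW dY; have k0 := F_Phi_neq0 Oy; have F0 := F_neq0 Oy.
have dF := diff_is_derive v (diff_F Oy); have dP := derive_Phi v Oy.
have dk m := is_derive_inv (f := fun z => (F z - Phi z) ^+ m)
  (expf_neq0 m k0) (is_derive_exp m (is_derive_sub dF dP)).
have dmP m := is_derive_mul (is_derive_const y v m) dP.
have d1 : is_derive y v c1 ('D_v c1 y) := is_derive_self (is_derive_mul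
  (is_derive_mul (is_derive_exp 2 dF) (is_derive_sub dF (dmP 2))) (dk 3)).
have d2 : is_derive y v c2 ('D_v c2 y) := is_derive_self (is_derive_mul
  (is_derive_mul (is_derive_const y v 3) (is_derive_exp 4 dF)) (dk 4)).
have d3 : is_derive y v c3 ('D_v c3 y) := is_derive_self (is_derive_mul
  (is_derive_mul (is_derive_mul (is_derive_exp 2 dF) dP)
    (is_derive_sub (dmP 4) dF)) (dk 4)).
have d4 : is_derive y v c4 ('D_v c4 y) := is_derive_self (is_derive_mul
  (is_derive_mul (is_derive_exp 3 dF) (is_derive_sub dF (dmP 4))) (dk 4)).
have dG := diff_is_derive v (diff_hessian_along Oy dW dY).
have pW := derive_phi_along v Oy dW; have pY := derive_phi_along v Oy dY.
have lW : is_derive y v (fun z => 'D_(W z) F z)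
    ((F y)^-1 * hb y (W y) v + 'D_('D_v W y) F y) := derive_dF_along v Oy dW.
have lY : is_derive y v (fun z => 'D_(Y z) F z)
    ((F y)^-1 * hb y (Y y) v + 'D_('D_v Y y) F y) := derive_dF_along v Oy dY.
have dB := is_derive_self (is_derive_mul d2 (is_derive_mul pW pY)).
have dH := is_derive_add (is_derive_add (is_derive_add (is_derive_mul d1 dG) dB)
  (is_derive_mul d3 (is_derive_mul lW lY)))
  (is_derive_mul d4 (is_derive_add (is_derive_mul pW lY) (is_derive_mul pY lW))).
have dhat := open_is_derive oO Oy (fun z => hessian_hat (W z) (Y z) (y := z)) dH.
(* Differentiating ell produces hbar / F, so the angular terms inherit the coefficients c3 / F and
   c4 / F. *)
have e3 : F y * Phi y * (4 * Phi y - F y) / (F y - Phi y) ^+ 4 = c3 y / F y.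
  by rewrite /c3; move: F0 k0; move: (F y) (Phi y) => r s F0 k0; field; apply/andP.
have e4 : F y ^+ 2 * (F y - 4 * Phi y) / (F y - Phi y) ^+ 4 = c4 y / F y.
  by rewrite /c4; move: F0 k0; move: (F y) (Phi y) => r s F0 k0; field; apply/andP.
apply: (etrans (congr1 (fun t => t - ghat y ('D_v W y) (Y y) - ghat y (W y) ('D_v Y y))
  (@derive_val _ _ _ _ _ _ _ dhat))).
rewrite (hessian_hat ('D_v W y) (Y y) Oy) (hessian_hat (W y) ('D_v Y y) Oy) e3 e4.
(* All quantities but [F y] are now made opaque: the identity is rational in them, with [F y] as the
   only denominator. *)
clear - F0.
move: ('D_v (fun z => g z (W z) (Y z)) y)
  ('D_v (fun z => c2 z * (phi z (W z) * phi z (Y z))) y) => G' B'.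
move: ('D_v c1 y) ('D_v c3 y) ('D_v c4 y) (hb y (W y) v) (hb y (Y y) v)
  (c1 y) (c2 y) (c3 y) (c4 y) => a1 a3 a4 hW hY k1 k2 k3 k4.
move: (phi y (W y)) (phi y (Y y)) (phi y ('D_v W y)) (phi y ('D_v Y y))
  => pW pY pW' pY'.
move: (g y (W y) (Y y)) (g y ('D_v W y) (Y y)) (g y (W y) ('D_v Y y))
  => G GW GY.
move: ('D_(W y) F y) ('D_(Y y) F y) ('D_('D_v W y) F y) ('D_('D_v Y y) F y)
  => lW lY lW' lY'.
by field.
Qed.

End Minkowski.

(** * Charts of a manifold and of its tangent bundle *)

Section Charts.
Variables (R : realType) (V : normedModType R) (M : Type) (A : atlas V M).

(* Both [A] and [tangent_atlas A] satisfy this when [A] is a smooth manifold. *)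
Record differentiable_atlas : Prop := DifferentiableAtlas {
  da_cover : forall x, dom (chart_at A x) x;
  da_inj : forall (c : chart A) x y,
    dom c x -> dom c y -> coord c x = coord c y -> x = y;
  da_open : forall c d : chart A, open (coord c @` (dom c `&` dom d));
  da_diff : forall (c d : chart A) x, dom c x -> dom d x ->
    differentiable (lrep c (coord d)) (coord c x) }.

Hypothesis HA : differentiable_atlas.

Lemma lrep_coord (W : normedModType R) (c : chart A) (f : M -> W) x :
  dom c x -> lrep c f (coord c x) = f x.
Proof.
move=> cx; apply: xget_unique; first by exists x.
by move=> _ [y [cy yx] <-]; rewrite (da_inj HA cy cx yx).
Qed.

Lemma da_open3 (c d e : chart A) :
  open (coord c @` (dom c `&` dom d `&` dom e)).
Proof.
have -> : coord c @` (dom c `&` dom d `&` dom e) =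
    coord c @` (dom c `&` dom d) `&` coord c @` (dom c `&` dom e).
  apply/seteqP; split=> [_ [x [[cx dx] ex] <-]|_ [[x [cx dx] <-] [y [cy ey] yx]]].
    by split; exists x.
  by move: (da_inj HA cy cx yx) => xy; subst y; exists x.
by apply: openI; exact: (da_open HA).
Qed.

Lemma derive_transition_comp (c d e : chart A) x v :
  dom c x -> dom d x -> dom e x ->
  'D_('D_v (lrep c (coord d)) (coord c x)) (lrep d (coord e)) (coord d x) =
  'D_v (lrep c (coord e)) (coord c x).
Proof.
move=> cx dx ex; rewrite -(lrep_coord (coord d) cx) -derive_comp; last 2 first.
- exact: (da_diff HA).
- by rewrite lrep_coord //; exact: (da_diff HA).
apply: (open_eq_derive _ (da_open3 c d e)); first by exists x.
by move=> _ [y [[cy dy] ey] <-] /=; rewrite !lrep_coord.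
Qed.

Lemma derive_transition_id (c : chart A) x v : dom c x ->
  'D_v (lrep c (coord c)) (coord c x) = v.
Proof.
move=> cx; rewrite -[RHS](derive_id (coord c x)).
apply: (open_eq_derive _ (da_open HA c c)); first by exists x.
by move=> _ [y [cy _] <-]; rewrite lrep_coord.
Qed.

Lemma to_chartK (c : chart A) x v :
  dom c x -> of_chart c x (to_chart c x v) = v.
Proof.
move=> cx; rewrite /of_chart /to_chart derive_transition_comp //;
  try exact: (da_cover HA).
by apply: derive_transition_id; exact: (da_cover HA).
Qed.

Lemma of_chartK (c : chart A) x v :
  dom c x -> to_chart c x (of_chart c x v) = v.
Proof.
move=> cx; rewrite /of_chart /to_chart derive_transition_comp //;
  try exact: (da_cover HA).
exact: derive_transition_id.
Qed.

Lemma to_chart_id x v : to_chart (chart_at A x) x v = v.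
Proof. by apply: derive_transition_id; exact: (da_cover HA). Qed.

Lemma to_chart_trans (c d : chart A) x v : dom c x -> dom d x ->
  'D_(to_chart c x v) (lrep c (coord d)) (coord c x) = to_chart d x v.
Proof. by move=> cx dx; apply: derive_transition_comp => //; exact: (da_cover HA). Qed.

Lemma of_chart_trans (c d : chart A) x v : dom c x -> dom d x ->
  to_chart d x (of_chart c x v) = 'D_v (lrep c (coord d)) (coord c x).
Proof. by move=> cx dx; apply: derive_transition_comp => //; exact: (da_cover HA). Qed.

Lemma vrep_const_field (c : chart A) (X : M -> V) x v : c = chart_at A x ->
  X = const_field A x v -> forall y, dom c y -> vrep X c (coord c y) = v.
Proof.
by move=> -> -> y cy; rewrite /vrep lrep_coord // of_chartK.
Qed.

End Charts.

(** * Transition maps of the tangent bundle *)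

Section TangentCharts.
Variables (R : realType) (n : nat) (M : topologicalType) (A : atlas 'rV[R]_n M).
Hypothesis HM : smooth_manifold A.
Local Notation V := ('rV[R]_n).
Local Notation TA := (tangent_atlas A).

Lemma manifold_atlas : differentiable_atlas A.
Proof.
have oc (c d : chart A) : open (coord c @` (dom c `&` dom d)).
  apply/(chart_homeo HM); first by move=> x [].
  by apply: openI; exact: (chart_open HM).
split=> //; first exact: (chart_cover HM).
  by move=> c x y cx cy; apply: (chart_inj HM) (mem_set cx) (mem_set cy).
by move=> c d x cx dx; apply: (chart_compat HM c d 1%N).1; exists x.
Qed.
Local Notation HA := manifold_atlas.

Lemma tangent_image (c d : chart A) (p : tangent A) :
  dom (a := TA) c p -> dom (a := TA) d p ->
  [set w : V * V | (coord c @` (dom c `&` dom d)) w.1] (coord (a := TA) c p).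
Proof. by move=> cp dp; exists (base p). Qed.

Lemma tangent_transitionE (c d : chart A) (w : V * V) :
  (coord c @` (dom c `&` dom d)) w.1 ->
  lrep (A := TA) c (coord (a := TA) d) w =
  (lrep c (coord d) w.1, 'D_(w.2) (lrep c (coord d)) w.1).
Proof.
case: w => u v [x [cx dx] /= <-].
apply: xget_unique.
  exists (Tangent A x (of_chart c x v)) => /=.
    by split=> //=; rewrite of_chartK //; exact: HA.
  by rewrite (lrep_coord HA (coord d) cx) (of_chart_trans HA v cx dx).
move=> _ [[y w] [/= cy [/= yx wv]] <-] /=.
move: yx wv => /(da_inj HA cy cx) -> <-.
by rewrite (lrep_coord HA (coord d) cx) (to_chart_trans HA w cx dx).
Qed.

Lemma tangent_transition_smooth (c d : chart A) k :
  Ck k [set w : V * V | (coord c @` (dom c `&` dom d)) w.1]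
    (fun w => 'D_(w.2) (lrep c (coord d)) w.1).
Proof.
set S := [set w | _]; have oO := da_open HA c d.
have oS : open S by apply: open_comp oO => w _; exact: cvg_fst.
have smf : smooth S (@fst V V).
  by apply: (@smooth_linear _ _ _ _ (@fst V V)) => w; exact: cvg_fst.
have sms : smooth S (@snd V V).
  by apply: (@smooth_linear _ _ _ _ (@snd V V)) => w; exact: cvg_snd.
by apply: (Ck_derive_along (u := fst) (w := snd) oS oO) => //;
  exact: (chart_compat HM c d k.+1).
Qed.

Lemma tangent_manifold_atlas : differentiable_atlas TA.
Proof.
have oS (c d : chart A) : open [set w : V * V | (coord c @` (dom c `&` dom d)) w.1].
  by apply: open_comp (da_open HA c d) => w _; exact: cvg_fst.
split.
- by move=> p; exact: (da_cover HA).
- move=> c [x v] [y w] /= cx cy [/(da_inj HA cx cy) <-] vw; congr Tangent.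
  by rewrite -(to_chartK HA v cx) vw (to_chartK HA).
- move=> /= c d; suff -> : coord (a := TA) c @` (dom (a := TA) c `&` dom (a := TA) d) =
      [set w : V * V | (coord (a := A) c @` (dom (a := A) c `&` dom (a := A) d)) w.1].
    exact: oS.
  apply/seteqP; split=> [_ [p [cp dp] <-]|[u v] [x [cx dx] /= <-]].
    exact: tangent_image.
  by exists (Tangent A x (of_chart c x v)) => //=; rewrite (of_chartK HA).
- move=> /= c d p cp dp.
  apply: (open_eq_differentiable (oS c d) (tangent_image cp dp)).
    by move=> w Sw; apply/esym; exact: tangent_transitionE.
  have [dt _] := tangent_transition_smooth c d 1.
  apply: differentiable_pair; last by apply: dt; exact: tangent_image.
  have H := (differentiable_comp (differentiable_fst (coord (a:=TA) c p)) (da_diff HA cp dp)).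
  exact: H.
Qed.

End TangentCharts.

(** * Vertical geometry in a fibre *)

Section Fibre.
Variables (R : realType) (n : nat) (M : topologicalType) (A : atlas 'rV[R]_n M).
Hypothesis HM : smooth_manifold A.
Local Notation V := ('rV[R]_n).
Local Notation VV := ('rV[R]_n * 'rV[R]_n)%type.
Local Notation TM := (tangent A).
Local Notation TA := (tangent_atlas A).
Local Notation HA := (manifold_atlas HM).
Local Notation HT := (tangent_manifold_atlas HM).
Implicit Types (p q : TM) (U : set TM) (c d : chart A).

Lemma coord_fibre x y :
  coord (a := TA) (chart_at A x) (Tangent A x y) = (coord (chart_at A x) x, y).
Proof. by rewrite /= (to_chart_id HA). Qed.

Lemma lrep_fibre (W : normedModType R) (f : TM -> W) x y :
  lrep (A := TA) (chart_at A x) f (coord (chart_at A x) x, y) = f (Tangent A x y).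
Proof.
by rewrite -coord_fibre (lrep_coord HT) //; exact: (da_cover HT (Tangent A x y)).
Qed.

Lemma open_fibre U x : atlas_open TA U -> open [set y | U (Tangent A x y)].
Proof.
move=> oU; set c := chart_at A x.
have -> : [set y | U (Tangent A x y)] =
    (fun y => (coord c x, y)) @^-1` (coord (a := TA) c @` (dom (a := TA) c `&` U)).
  apply/seteqP; split=> y => [Uy|[q [cq Uq] qy]].
    exists (Tangent A x y); last exact: coord_fibre.
    by split=> //; exact: (da_cover HA x).
  have qE : coord (a := TA) c q = coord (a := TA) c (Tangent A x y).
    by rewrite coord_fibre.
  by move: (@da_inj _ _ _ _ HT c q (Tangent A x y) cq (da_cover HA x) qE) Uq => ->.
apply: open_comp (oU c) => y _.
exact: differentiable_continuous (differentiable_pairr (coord c x) y).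
Qed.

Lemma Ck_fibre (W : normedModType R) k U (f : TM -> W) x : atlas_open TA U ->
  Ck k (coord (a := TA) (chart_at A x) @` (dom (a := TA) (chart_at A x) `&` U))
    (lrep (A := TA) (chart_at A x) f) ->
  Ck k [set y | U (Tangent A x y)] (fun y => f (Tangent A x y)).
Proof.
move=> oU cf.
have -> : (fun y => f (Tangent A x y)) =
    (fun y => lrep (A := TA) (chart_at A x) f (coord (chart_at A x) x, y)).
  by apply/funext => y; rewrite lrep_fibre.
apply: Ck_slice cf; first exact: open_fibre.
move=> y Uy; rewrite -coord_fibre; exists (Tangent A x y) => //; split=> //.
exact: (da_cover HA).
Qed.

Lemma pi_vector_field_fibre U (W : TM -> V) x :
  atlas_open TA U -> pi_vector_field U W ->
  smooth [set y | U (Tangent A x y)] (fun y => W (Tangent A x y)).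
Proof.
move=> oU sW k.
have := Ck_fibre (x := x) oU (sW (chart_at A x) k).
apply: Ck_eq; first exact: open_fibre.
by move=> y _; exact: (to_chart_id HA).
Qed.

Lemma derive_vertical (W : normedModType R) (f : VV -> W) p b :
  'D_(0, b) f (coord (a := TA) (chart_at A (base p)) p) =
  'D_b (fun y => f (coord (chart_at A (base p)) (base p), y)) (fibre p).
Proof.
apply: derive_lineE => t; case: p => x y; rewrite coord_fibre.
by congr f; congr (_, _); rewrite /= scaler0 addr0.
Qed.

Lemma vertical_differential (f : TM -> R) p b :
  differential TA f p (0, b) = 'D_b (fun y => f (Tangent A (base p) y)) (fibre p).
Proof.
rewrite /differential derive_vertical; congr ('D_b _ _).
by apply/funext => y; exact: lrep_fibre.
Qed.

Lemma dJE (f : TM -> R) p xi :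
  dJ f p xi = 'D_(xi.1) (fun y => f (Tangent A (base p) y)) (fibre p).
Proof. exact: vertical_differential. Qed.

Lemma transition_fst c d p (xi : VV) : dom c (base p) -> dom d (base p) ->
  ('D_xi (lrep (A := TA) c (coord (a := TA) d)) (coord (a := TA) c p)).1 =
  'D_(xi.1) (lrep c (coord d)) (coord c (base p)).
Proof.
move=> cp dp; set T := lrep _ _; set w := coord _ _.
have dT : differentiable T w by apply: (da_diff HT).
rewrite -(derive_fst (T w)) -derive_comp //; last exact: differentiable_fst.
rewrite -(derive_fst w xi) -(derive_comp (g := lrep c (coord d))); last 2 first.
- exact: differentiable_fst.
- exact: (da_diff HA).
have oS : open [set w : VV | (coord c @` (dom c `&` dom d)) w.1].
  by apply: open_comp (da_open HA c d) => z _; exact: cvg_fst.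
apply: (open_eq_derive _ oS); first exact: tangent_image.
by move=> z Sz /=; rewrite /T (tangent_transitionE HM Sz).
Qed.

(** Over a fixed base point the change of coordinates is constant in the first component and linear
    in y in the second, hence its own derivative there. *)
Lemma transition_vertical c d p (b : V) : dom c (base p) -> dom d (base p) ->
  'D_(0, b) (lrep (A := TA) c (coord (a := TA) d)) (coord (a := TA) c p) =
  (0, 'D_b (lrep c (coord d)) (coord c (base p))).
Proof.
move=> cp dp; set u := coord c (base p).
have dt : differentiable (lrep c (coord d)) u by exact: (da_diff HA).
rewrite (derive_lineE (g := fun v => (lrep c (coord d) u, 'D_v (lrep c (coord d)) u))
    (u' := to_chart c (base p) (fibre p)) (v' := b)); last first.
  move=> t; rewrite (tangent_transitionE HM) /= scaler0 addr0 //.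
  by exists (base p).
rewrite (derive_pair _ (differentiable_cst _ _) (differentiable_direction _ dt)).
by rewrite derive_cst (derive_direction _ _ dt).
Qed.

Lemma rho_to_chart c p (xi : VV) : dom c (base p) ->
  (to_chart (A := TA) c p xi).1 = to_chart c (base p) xi.1.
Proof. by move=> cp; apply: transition_fst => //; exact: (da_cover HA). Qed.

Lemma rho_of_chart c p (xi : VV) : dom c (base p) ->
  (of_chart (A := TA) c p xi).1 = of_chart c (base p) xi.1.
Proof. by move=> cp; apply: transition_fst => //; exact: (da_cover HA). Qed.

Lemma to_chart_vertical c p (b : V) : dom c (base p) ->
  to_chart (A := TA) c p (0, b) = (0, to_chart c (base p) b).
Proof. by move=> cp; apply: transition_vertical => //; exact: (da_cover HA). Qed.

(** The preferred chart of a point of TM depends on its base only, so along the fibre the field is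
    read in the very chart that defines it. *)
Lemma const_field_fibre p (xi : VV) y :
  const_field TA p xi (Tangent A (base p) y) = xi.
Proof. by apply: (derive_transition_id HT); exact: (da_cover HA). Qed.

(** The exterior derivative has two terms. One is the vertical Hessian ([vE]); in the other ([hE])
    [dJ] is applied to a field that stays vertical over the whole chart domain, hence vanishes
    there, and so does its derivative in the direction (b, 0). *)
Lemma metricE (F : TM -> R) p a b :
  metric F p a b =
  'D_a ('D_b (fun y => energy F (Tangent A (base p) y))) (fibre p).
Proof.
have vE : differential TA (fun q => dJ (energy F) q (const_field TA p (b, 0) q)) p
    (gamma a) = 'D_a ('D_b (fun y => energy F (Tangent A (base p) y))) (fibre p).
  apply: (etrans (vertical_differential _ p a)).
  suff -> : (fun y => dJ (energy F) (Tangent A (base p) y)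
      (const_field TA p (b, 0) (Tangent A (base p) y))) =
    'D_b (fun y => energy F (Tangent A (base p) y)) by [].
  by apply/funext => y; rewrite (const_field_fibre p (b, 0) y); exact: dJE.
have hE : differential TA
    (fun q => dJ (energy F) q (const_field TA p (gamma a) q)) p (b, 0) = 0.
  set c := chart_at A (base p).
  rewrite -[RHS](derive_cst (0 : R) (coord (a := TA) c p) (b, 0)).
  apply: (open_eq_derive _ (da_open HT c c)).
    by exists p => //; split; exact: (da_cover HT p).
  move=> _ [q [cq _] <-]; rewrite (lrep_coord HT _ cq) dJE.
  have -> : (const_field TA p (gamma a) q).1 = 0; last exact: derive0.
  apply: (etrans (rho_of_chart _ cq)); exact: derive0.
exact (etrans (congr2 (fun s t => s - t) vE hE) (subr0 _)).
Qed.

Lemma vrep_fibre (X : TM -> VV) x y :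
  vrep (A := TA) X (chart_at A x) (coord (chart_at A x) x, y) = X (Tangent A x y).
Proof. by rewrite /vrep lrep_fibre; exact: (to_chart_id HT (Tangent A x y)). Qed.

(** * Coordinate expressions of the Barthel connection and of the vertical Berwald derivative *)

Section Spray.
Variables (U : set TM) (G : TM -> VV).
Hypotheses (oU : atlas_open TA U) (sG : vector_field TA U G).
Hypothesis JG : forall p, U p -> J (G p) = liouville p.

Let G2 x y := (G (Tangent A x y)).2.

Lemma spray_fibre p : U p -> G p = (fibre p, (G p).2).
Proof.
by move=> /JG /(congr1 snd) /= Gp; rewrite [LHS]surjective_pairing; congr (_, _).
Qed.

Lemma spray_smooth x : smooth [set y | U (Tangent A x y)] (G2 x).
Proof.
move=> k; have : Ck k [set y | U (Tangent A x y)] (fun y => G (Tangent A x y)).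
  have := Ck_fibre (x := x) oU (sG (chart_at A x) k).
  apply: Ck_eq; first exact: open_fibre.
  by move=> y _; exact: (to_chart_id HT (Tangent A x y)).
by move=> cG; exact (Ck_snd (open_fibre oU) cG).
Qed.

Lemma derive_spray_fibre p a : U p ->
  'D_(0, a) (vrep (A := TA) G (chart_at A (base p)))
    (coord (a := TA) (chart_at A (base p)) p) =
  (a, 'D_a (G2 (base p)) (fibre p)).
Proof.
case: p => x y Up; apply: (etrans (derive_vertical _ _ _)).
have [dG _] := @spray_smooth x 1.
have <- : 'D_a (fun z => (z, G2 x z)) y = (a, 'D_a (G2 x) y).
  by rewrite (derive_pair a _ (dG _ Up)) // derive_id.
apply: (open_eq_derive _ (open_fibre oU) Up) => z Uz.
by rewrite vrep_fibre [LHS](spray_fibre Uz).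
Qed.

(** By JG = C, the base components of [G] are the fibre coordinates in any chart, also off the fibre
    of [p]; so directions with a horizontal part are allowed. *)
Lemma derive_spray_fst p (xi : VV) : U p ->
  ('D_xi (vrep (A := TA) G (chart_at A (base p)))
    (coord (a := TA) (chart_at A (base p)) p)).1 = xi.2.
Proof.
set c := chart_at A (base p); set w := coord (a := TA) c p => Up.
have Sw : (coord (a := TA) c @` (dom (a := TA) c `&` U)) w.
  by exists p => //; split=> //; exact: (da_cover HA (base p)).
have [dG _] := sG c 1.
rewrite -(derive_fst (vrep (A := TA) G c w)).
rewrite -(derive_comp _ (dG _ Sw) (differentiable_fst _)).
rewrite -[RHS](derive_snd w).
apply: (@open_eq_derive _ _ _ _ (fst \o vrep (A := TA) G c) snd _ _ (@oU c) Sw).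
move=> _ [q [cq Uq] <-].
apply: (etrans (congr1 fst (lrep_coord HT _ (cq : dom (a := TA) c q)))).
by rewrite (rho_to_chart (p := q) (G q) cq) (spray_fibre Uq).
Qed.

(** For a field X with constant components, JX has constant components too, so both [JX, G] and
    [X, G] reduce to derivatives of [G]. *)
Lemma barthelE p (xi : VV) : U p ->
  barthel G p xi = (xi.1, 'D_(xi.1) (G2 (base p)) (fibre p) - xi.2).
Proof.
move=> Up; set c := chart_at A (base p); set X := const_field TA p xi.
have Xp : X p = xi by case: p @c @X Up => x y c X _; exact: const_field_fibre.
have cp : dom (a := TA) c p by exact: (da_cover HA (base p)).
have Sw : (coord (a := TA) c @` (dom (a := TA) c `&` dom (a := TA) c))
    (coord (a := TA) c p) by exists p.
have vX : 'D_(G p) (vrep (A := TA) X c) (coord (a := TA) c p) = 0.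
  rewrite -[RHS](derive_cst xi (coord (a := TA) c p) (G p)).
  apply: (open_eq_derive _ (da_open HT c c) Sw) => _ [q [cq _] <-].
  exact: (vrep_const_field HT (x := p)).
have vJX : 'D_(G p) (vrep (A := TA) (fun q => J (X q)) c) (coord (a := TA) c p) = 0.
  rewrite -[RHS](derive_cst (gamma xi.1) (coord (a := TA) c p) (G p)).
  apply: (open_eq_derive _ (da_open HT c c) Sw) => _ [q [cq _] <-].
  apply: (etrans (lrep_coord HT _ cq)).
  rewrite [LHS](to_chart_vertical (p := q) (X q).1 cq); congr (_, _).
  rewrite (rho_of_chart (p := q) xi cq); exact: (of_chartK HA).
have JXG : bracket TA (fun q => J (X q)) G p =
    (xi.1, 'D_(xi.1) (G2 (base p)) (fibre p)).
  apply: (etrans (congr2 (fun s t => s - t) (erefl _) vJX)).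
  by rewrite subr0 Xp; exact: derive_spray_fibre.
have XG : (bracket TA X G p).1 = xi.2.
  apply: (etrans (congr2 (fun s t : VV => s.1 - t.1) (erefl _) vX)).
  by rewrite subr0 Xp; exact: derive_spray_fst.
apply: (etrans (congr2 (fun s t => s - gamma t) JXG XG)).
by congr (_, _); rewrite /= subr0.
Qed.

(** The projector h sends (a, b) to (a, D_a G2 / 2), whatever b is. Its image is thus a graph over
    the horizontal components, and the vector chosen by [xget] is unique. *)
Lemma betaE p w : U p ->
  beta G p w = (w, 2^-1 *: 'D_w (G2 (base p)) (fibre p)).
Proof.
move=> Up.
have half (a : V) : 2^-1 *: (a + a) = a.
  by rewrite -mulr2n -[a *+ 2]scaler_nat scalerA mulVf ?scale1r // pnatr_eq0.
have hE xi : hproj G p xi = (xi.1, 2^-1 *: 'D_(xi.1) (G2 (base p)) (fibre p)).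
  rewrite /hproj barthelE //; case: xi => a b; congr (_, _) => /=.
    exact: half.
  by congr (_ *: _); exact: subrKC.
apply: xget_unique; first by split=> //; exists (w, 0) => //; rewrite hE.
by move=> _ [[xi _ <-]]; rewrite hE /= => ->.
Qed.

(** [rho] reads the first component of the bracket: that of [beta W] is W itself, and that of
    [gamma Z] is zero in every chart. The spray affects only the second component of [beta W]. *)
Lemma berwald_vE (Z W : TM -> V) p :
  pi_vector_field U Z -> pi_vector_field U W -> U p ->
  berwald_v G Z W p = 'D_(Z p) (fun y => W (Tangent A (base p) y)) (fibre p).
Proof.
case: p => x y; set p := Tangent A x y; set c := chart_at A x => sZ sW Up.
have oF := open_fibre (x := x) oU.
have smW k : Ck k [set z | U (Tangent A x z)] (fun z => W (Tangent A x z)).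
  exact: pi_vector_field_fibre.
have [dW _] := smW 1%N.
(* The second component is discarded in the end, but the derivative of the pair splits only once
   both components are known to be differentiable. *)
have cD : Ck 1 [set z | U (Tangent A x z)]
    (fun z => 'D_(W (Tangent A x z)) (G2 x) z).
  apply: (Ck_derive_along (u := id) oF oF) => //; last exact: spray_smooth.
  by apply: (@smooth_linear _ _ _ _ (@idfun V)) => ?; exact: cvg_id.
have vE : ('D_(vert Z p) (vrep (A := TA) (hor G W) c) (coord (a := TA) c p)).1 =
    'D_(Z p) (fun z => W (Tangent A x z)) y.
  rewrite [X in X.1](derive_vertical (vrep (A := TA) (hor G W) c) p (Z p)).
  rewrite (@open_eq_derive _ _ _ _ _
    (fun z => (W (Tangent A x z), 2^-1 *: 'D_(W (Tangent A x z)) (G2 x) z))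
    _ _ oF Up); last first.
    by move=> z Uz; rewrite vrep_fibre; exact: (betaE _ Uz).
  rewrite (derive_pair _ (dW _ Up)) //.
  by apply: differentiableZ; exact: (cD.1 _ Up).
have hE : ('D_(hor G W p) (vrep (A := TA) (vert Z) c) (coord (a := TA) c p)).1 = 0.
  have Sw : (coord (a := TA) c @` (dom (a := TA) c `&` U)) (coord (a := TA) c p).
    by exists p => //; split=> //; exact: (da_cover HA x).
  pose f : VV -> V := lrep (A := TA) c (fun q => to_chart c (base q) (Z q)).
  have [df _] := sZ c 1%N.
  rewrite (@open_eq_derive _ _ _ _ _ (fun w => (0, f w)) _ _ (@oU c) Sw); last first.
    move=> _ [q [cq Uq] <-]; rewrite /f.
    rewrite [LHS](lrep_coord HT _ cq) (lrep_coord HT _ cq).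
    exact: (to_chart_vertical (p := q)).
  by rewrite (derive_pair _ (differentiable_cst _ _) (df _ Sw)) derive_cst.
by apply: (etrans (congr2 (fun s t : V => s - t) vE hE)); rewrite subr0.
Qed.

End Spray.
End Fibre.

(** * The concurrent field restricted to a fibre *)

Section ConcurrentFibre.
Variables (R : realType) (n : nat) (M : topologicalType) (A : atlas 'rV[R]_n M).
Hypothesis HM : smooth_manifold A.
Local Notation V := ('rV[R]_n).
Local Notation VV := ('rV[R]_n * 'rV[R]_n)%type.
Local Notation TM := (tangent A).
Local Notation TA := (tangent_atlas A).
Local Notation HA := (manifold_atlas HM).
Local Notation HT := (tangent_manifold_atlas HM).

Lemma chart_image_sub (c : chart A) (U U' : set TM) : U' `<=` U ->
  coord (a := TA) c @` (dom (a := TA) c `&` U') `<=`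
  coord (a := TA) c @` (dom (a := TA) c `&` U).
Proof. by move=> sU _ [q [cq Uq] <-]; exists q => //; split=> //; exact: sU. Qed.

Lemma pi_vector_field_sub (U U' : set TM) W : U' `<=` U ->
  pi_vector_field U W -> pi_vector_field U' W.
Proof. by move=> sU sW c k; apply: Ck_sub (sW c k); exact: chart_image_sub. Qed.

Lemma vector_field_sub (U U' : set TM) G : U' `<=` U ->
  vector_field TA U G -> vector_field TA U' G.
Proof. by move=> sU sG c k; apply: Ck_sub (sG c k); exact: chart_image_sub. Qed.

Lemma atlas_open_dom (U : set TM) (c : chart A) : atlas_open TA U ->
  atlas_open TA (U `&` dom (a := TA) c).
Proof.
move=> oU d.
have -> : coord (a := TA) d @` (dom (a := TA) d `&` (U `&` dom (a := TA) c)) =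
    coord (a := TA) d @` (dom (a := TA) d `&` U) `&`
    coord (a := TA) d @` (dom (a := TA) d `&` dom (a := TA) c).
  apply/seteqP; split=> [_ [q [dq [Uq cq]] <-]|_ [[q [dq Uq] <-] [r [dr cr] rq]]].
    by split; exists q.
  move: (da_inj HT (dr : dom (a := TA) d r) (dq : dom (a := TA) d q) rq) => e.
  by subst r; exists q.
by apply: openI; [exact: oU|exact: (da_open HT)].
Qed.

(** Supplies test fields for the Cartan connection, which must be smooth over an open set. In
    another chart d their components are the derivative in the direction [a] of the transition from
    c to d, so they are smooth over [dom c]. *)
Lemma of_chart_pi_vector_field (U : set TM) (c : chart A) a : atlas_open TA U ->
  pi_vector_field (U `&` dom (a := TA) c) (fun q => of_chart c (base q) a).
Proof.
move=> oU d k; set S := _ @` _.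
have oS : open S by exact: (@atlas_open_dom U c oU d).
have smf : Ck k S (@fst V V).
  by apply: (@smooth_linear _ _ _ _ (@fst V V)) => w; exact: cvg_fst.
have oO (e e' : chart A) := da_open HA e e'.
have Sd w : S w -> (coord d @` (dom d `&` dom c)) w.1.
  by move=> [q [dq [_ cq]] <-]; exists (base q).
have Sc w : S w -> (coord c @` (dom c `&` dom d)) (lrep d (coord c) w.1).
  move=> [q [dq [_ cq]] <-] /=; exists (base q) => //.
  exact: esym (lrep_coord HA (coord c) dq).
have Ct : Ck k S (lrep d (coord c) \o @fst V V).
  exact: (Ck_comp oS (oO d c) Sd smf (chart_compat HM d c k)).
have := Ck_derive_along oS (oO c d) Sc Ct (Ck_cst k S a) (chart_compat HM c d k.+1).
apply: (Ck_eq oS) => _ [q [dq [_ cq]] <-].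
rewrite (lrep_coord HT _ (dq : dom (a := TA) d q)) (of_chart_trans HA a cq dq) /=.
by rewrite (lrep_coord HA (coord c) dq).
Qed.

Lemma metric0l (F : TM -> R) p b : metric F p 0 b = 0.
Proof. by rewrite (metricE HM); exact: derive0. Qed.

Lemma metric0r (F : TM -> R) p a : metric F p a 0 = 0.
Proof.
rewrite (metricE HM).
have -> : 'D_(0 : V) (fun y => energy F (Tangent A (base p) y)) = (fun=> 0).
  by apply/funext => y; exact: derive0.
exact: derive_cst.
Qed.

Variables (D : set TM) (F : TM -> R) (G : TM -> VV).
Variable nabla : (TM -> VV) -> (TM -> V) -> TM -> V.
Variable vphi : TM -> V.
Hypotheses (oD : atlas_open TA D) (Dslit : D `<=` slit (A := A)).
Hypothesis Gspray : geodesic_spray (slit (A := A)) F G.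
Hypothesis Hnabla : cartan_connection F G nabla.
Hypothesis Hphi : concurrent G nabla vphi.

(* The [v]-equation of the Cartan connection, for [nabla_(gamma X) vphi = 0] and
   [D_(gamma X) vphi = 0] and fields constant in the chart at [x]. *)
Lemma phi_fibre_cst x y a b : D (Tangent A x y) ->
  'D_b (fun z => metric F (Tangent A x z) (vphi (Tangent A x z)) a) y = 0.
Proof.
move=> Dy; set c := chart_at A x; set U := D `&` dom (a := TA) c.
have oU : atlas_open TA U by exact: atlas_open_dom.
have Uslit : U `<=` slit (A := A) by move=> q [/Dslit].
have Up : U (Tangent A x y) by split=> //; exact: (da_cover HA x).
pose K e : TM -> V := fun q => of_chart c (base q) e.
have KE e z : K e (Tangent A x z) = e.
  by apply: (derive_transition_id HA); exact: (da_cover HA x).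
have sK e : pi_vector_field U (K e) by exact: of_chart_pi_vector_field.
have sphi : pi_vector_field U vphi.
  exact: pi_vector_field_sub Uslit (concurrent_field Hphi).
have [_ _ n0 D0] := concurrent_eqs Hphi oU Uslit (sK b) Up.
have sG := vector_field_sub Uslit (spray_field Gspray).
have JG q : U q -> J (G q) = liouville q by move=> /Uslit /(spray_J Gspray).
set p := Tangent A x y in Up n0 D0 *.
(* Up to sign this is the Berwald derivative of [K a] along [K b], and [K a] is constant in the
   fibre. *)
have B0 : rho (bracket TA (hor G (K a)) (vert (K b)) p) = 0.
  have Ka : (fun z => K a (Tangent A x z)) = cst a by apply/funext => z; exact: KE.
  have := berwald_vE HM oU sG JG (sK b) (sK a) Up.
  rewrite [X in 'D__ X _]Ka derive_cst => DK.
  apply: oppr_inj; rewrite oppr0 -[RHS]DK; exact: opprB.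
have m0 : metric F p (nabla (vert (K b)) vphi p) (K a p) = 0.
  by rewrite n0 metric0l.
have m1 : metric F p (vphi p) (rho (bracket TA (hor G (K a)) (vert (K b)) p)) = 0.
  by rewrite B0 metric0r.
have m2 : metric F p (K a p) (rho (bracket TA (vert (K b)) (hor G vphi) p)) = 0.
  exact: (etrans (congr1 (metric F p (K a p)) D0) (metric0r _ _ _)).
have H := cartan_v Hnabla oU Uslit (sK b) sphi (sK a) Up.
have {}H := etrans (esym (congr1 (fun t => 2 * t) m0))
  (etrans H (congr2 (fun s t => _ + s + t) m1 m2)).
rewrite mulr0 !addr0 in H; rewrite [RHS]H /act /vert KE.
have fE : (fun z => metric F (Tangent A x z) (vphi (Tangent A x z)) a) =
    (fun z => metric F (Tangent A x z) (vphi (Tangent A x z)) (K a (Tangent A x z))).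
  by apply/funext => z; rewrite KE.
apply: (etrans (congr1 (fun f => 'D_b f y) fE)).
exact: (esym (vertical_differential HM
  (fun q => metric F q (vphi q) (K a q)) (Tangent A x y) b)).
Qed.

End ConcurrentFibre.

(** * From a single fibre to the manifold *)

Lemma spray_berwald_vE (R : realType) (n : nat) (M : topologicalType)
    (A : atlas 'rV[R]_n M) (HM : smooth_manifold A) (U D : set (tangent A)) F G
    (Z W : tangent A -> 'rV[R]_n) p :
  geodesic_spray U F G -> D `<=` U -> atlas_open (tangent_atlas A) D ->
  pi_vector_field D Z -> pi_vector_field D W -> D p ->
  berwald_v G Z W p = 'D_(Z p) (fun y => W (Tangent A (base p) y)) (fibre p).
Proof.
move=> sG DU oD; apply: (berwald_vE HM oD).
  exact: (vector_field_sub DU (spray_field sG)).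
by move=> q /DU; exact: (spray_J sG).
Qed.

Theorem proposition2p8 (R : realType) (n : nat) (M : topologicalType)
    (A : atlas 'rV[R]_n M) (F : tangent A -> R)
    (G : tangent A -> 'rV[R]_n * 'rV[R]_n)
    (nabla : (tangent A -> 'rV[R]_n * 'rV[R]_n) ->
             (tangent A -> 'rV[R]_n) -> tangent A -> 'rV[R]_n)
    (vphi : tangent A -> 'rV[R]_n)
    (Ghat : tangent A -> 'rV[R]_n * 'rV[R]_n) :
  smooth_manifold A -> finsler F ->
  geodesic_spray (slit (A := A)) F G -> cartan_connection F G nabla ->
  concurrent G nabla vphi ->
  let g := metric F in
  let ell := supporting F in
  let hbar := angular F in
  let phi := fun p a => g p (vphi p) a in
  let Phi := fun p => phi p (eta p) in
  let p2 := fun p => g p (vphi p) (vphi p) in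
  let D : set (tangent A) := [set p | slit p /\ Phi p < F p] in
  let Fhat := fun p => F p ^+ 2 / (F p - Phi p) in
  conic_pseudo_finsler D Fhat ->
  (forall p, D p -> F p * (1 + 2 * p2 p) - 3 * Phi p != 0) ->
  geodesic_spray D Fhat Ghat ->
  forall W Y Z : tangent A -> 'rV[R]_n,
  pi_vector_field D W -> pi_vector_field D Y -> pi_vector_field D Z ->
  forall p, D p ->
  2 * cartan_torsion Fhat Ghat W Y Z p =
    2 * F p ^+ 2 * (F p - 2 * Phi p) / (F p - Phi p) ^+ 3
      * cartan_torsion F G W Y Z p
  + F p * Phi p * (4 * Phi p - F p) / (F p - Phi p) ^+ 4
      * (hbar p (W p) (Z p) * ell p (Y p) + hbar p (Y p) (Z p) * ell p (W p))
  + F p ^+ 2 * (F p - 4 * Phi p) / (F p - Phi p) ^+ 4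
      * (hbar p (W p) (Z p) * phi p (Y p) + hbar p (Y p) (Z p) * phi p (W p))
  + berwald_v_fun Z
      (fun q => F q ^+ 2 * (F q - 2 * Phi q) / (F q - Phi q) ^+ 3) p
      * g p (W p) (Y p)
  + berwald_v_tensor G Z
      (fun q a b => 3 * F q ^+ 4 / (F q - Phi q) ^+ 4 * (phi q a * phi q b))
      W Y p
  + berwald_v_fun Z
      (fun q => F q ^+ 2 * Phi q * (4 * Phi q - F q) / (F q - Phi q) ^+ 4) p
      * (ell p (W p) * ell p (Y p))
  + berwald_v_fun Z
      (fun q => F q ^+ 3 * (F q - 4 * Phi q) / (F q - Phi q) ^+ 4) p
      * (phi p (W p) * ell p (Y p) + phi p (Y p) * ell p (W p)).
Proof.
move=> HM HF HG HN HC g ell hbar phi Phi p2 D Fhat HD _ HGhat W Y Z sW sY sZ.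
case=> x y Dp; set p := Tangent A x y in Dp *.
have oD := conic_open (cpf_domain HD).
have Dslit : D `<=` slit (A := A) by move=> q [].
pose T z := Tangent A x z; pose S := [set z | D (T z)]; pose f z := F (T z).
have oS : open S := open_fibre HM oD.
have sf : smooth S f.
  move=> k; apply: (Ck_fibre HM oD).
  apply: (Ck_sub _ (finsler_smooth HF k (chart_at A x))).
  exact: chart_image_sub.
have hom t z : 0 < t -> S z -> S (t *: z) /\ f (t *: z) = t * f z.
  move=> t0 Sz; split; first exact: (conic_scale (cpf_domain HD) t0 Sz).
  exact: (finsler_homogeneous HF (T z) t0).
have dfib (X : tangent A -> 'rV[R]_n) z : pi_vector_field D X -> S z ->
    differentiable (fun z => X (T z)) z.
  move=> sX Sz; have smX : smooth S (fun z => X (T z)).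
    exact: (pi_vector_field_fibre HM x oD sX).
  exact: (smX 1%N).1.
have svphi := pi_vector_field_sub Dslit (concurrent_field HC).
have dvphi z (Sz : S z) := dfib _ _ svphi Sz.
have gE z a b : g (T z) a b = 'D_a ('D_b (fun z => 2^-1 * f z ^+ 2)) z.
  exact: (metricE HM F (T z) a b).
have ghatE z a b : metric Fhat (T z) a b =
    'D_a ('D_b (fun z => 2^-1 * (f z ^+ 2 / (f z - g (T z) (vphi (T z)) z)) ^+ 2)) z.
  exact: (metricE HM Fhat (T z) a b).
have phiC z a b (Sz : S z) := phi_fibre_cst HM oD Dslit HG HN HC a b Sz.
have PhiF z : S z -> g (T z) (vphi (T z)) z < f z by case.
set v := Z p; have dW := dfib W y sW Dp; have dY := dfib Y y sY Dp.
have key := torsion_hat oS sf gE hom dvphi phiC PhiF ghatE v Dp dW dY.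
have ellE a : ell p a = 'D_a f y := supportingE oS sf gE hom PhiF a Dp.
have bf h : berwald_v_fun Z h p = 'D_v (fun z => h (T z)) y.
  exact: (vertical_differential HM h p v).
have bG X : pi_vector_field D X -> berwald_v G Z X p = 'D_v (fun z => X (T z)) y.
  by move=> sX; exact: (spray_berwald_vE HM HG Dslit oD sZ sX Dp).
(* [Ghat] is a spray on [D] only, [G] on the whole slit bundle; over [D] both yield the same fibre
   derivative. *)
have bGhat X : pi_vector_field D X ->
    berwald_v Ghat Z X p = 'D_v (fun z => X (T z)) y.
  by move=> sX; exact: (spray_berwald_vE HM HGhat (@subset_refl _ D) oD sZ sX Dp).
have tensorE G' B : berwald_v G' Z W p = 'D_v (fun z => W (T z)) y ->
    berwald_v G' Z Y p = 'D_v (fun z => Y (T z)) y ->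
    berwald_v_tensor G' Z B W Y p =
    'D_v (fun z => B (T z) (W (T z)) (Y (T z))) y
    - B p ('D_v (fun z => W (T z)) y) (Y p) - B p (W p) ('D_v (fun z => Y (T z)) y).
  by move=> eW eY; rewrite /berwald_v_tensor bf eW eY.
have two (t : R) : 2 * (2^-1 * t) = t by rewrite mulrA mulfV ?mul1r // pnatr_eq0.
rewrite /cartan_torsion two (tensorE Ghat _ (bGhat _ sW) (bGhat _ sY)).
rewrite (tensorE G _ (bG _ sW) (bG _ sY)) (tensorE G _ (bG _ sW) (bG _ sY)) !bf.
apply: (etrans key); rewrite /hbar /angular -/g -/(ell p) !ellE.
(* [torsion_hat] has c1 times the derivative of the metric, which is twice the torsion; the factor 2
   moves into the coefficient. *)
have regroup (a b c t : R) : a * b / c * t = 2 * a * b / c * (2^-1 * t).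
  rewrite -[LHS]two; ring.
congr (_ + _ + _ + _ + _ + _ + _); exact: regroup.
Qed.
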